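(* Let $p\ge1$ be an integer. There is a function $v(\varepsilon)$, defined and satisfying $v(\varepsilon)<0$ for all $\varepsilon>0$ for which $u_{\varepsilon,2p}$ exists, such that for every $f:\{0,\tfrac1{2p},\dots,\tfrac{2p-1}{2p}\}\to\mathbb R$ (extended by $f(1)=f(0)$), the variation of nodes $$a_i(t)=\frac{i}{2p}+t\,f\!\left(\frac{i}{2p}\right),\qquad i=0,\dots,2p-1,$$ satisfies $$\frac{d^2}{dt^2}\Big|_{t=0}\mathrm{BE}_\varepsilon(\{a_i(t)\}_{i=0}^{2p-1})=\varepsilon\,c^2\,v(\varepsilon)\sum_{i=0}^{2p-1}\left[f\!\left(\tfrac{i}{2p}\right)-f\!\left(\tfrac{i+1}{2p}\right)\right]^2,$$ where $c=\partial_xu_{\varepsilon,2p}(0)>0$.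
   Context: $S^1\cong[0,1]$ with $0\sim1$. $W(u)=\frac{(1-u^2)^2}{4}$ and $E_\varepsilon(u,I)=\int_I\frac\varepsilon2|u'|^2+\frac1\varepsilon W(u)$. For all $\varepsilon$ sufficiently small (depending on $p$) there is a positive minimizer $u^+_{\varepsilon,2p}$ of $E_\varepsilon$ on $[0,\frac1{2p}]$ with zero Dirichlet conditions; $u_{\varepsilon,2p}$ is the solution of $\varepsilon^2u''=W'(u)$ on $S^1$ given by $u_{\varepsilon,2p}(x)=(-1)^iu^+_{\varepsilon,2p}(x-\frac{i}{2p})$ for $x\in[\frac i{2p},\frac{i+1}{2p}]$; it vanishes exactly on $Y_{2p}=\{i/(2p)\}_{i=0}^{2p-1}$. For a set of $2p$ points $a_0<a_1<\dots<a_{2p-1}$ on $S^1$, $\mathrm{BE}_\varepsilon(\{a_i\})$ is the sum over the $2p$ complementary intervals of the minimum of $E_\varepsilon$ on that interval among functions vanishing at its endpoints. *)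

(* Defs.v *)
From HB Require Import structures.
From mathcomp Require Import all_boot all_order all_algebra.
From mathcomp Require Import all_classical all_reals all_analysis.

Set Implicit Arguments.
Unset Strict Implicit.
Unset Printing Implicit Defensive.

Import Order.TTheory GRing.Theory Num.Theory.
Import numFieldNormedType.Exports.

Local Open Scope classical_set_scope.
Local Open Scope ring_scope.

Section AllenCahn.
Context {R : realType}.
Local Notation mu := (@lebesgue_measure R).

(* The least element of a set of reals, when there is one (0 otherwise). *)
Definition minimum (S : set R) : R := xget 0 [set m | S m /\ lbound S m].

(* On a bounded interval, u has (the continuous representative of) a weak
   derivative g in L^1 iff u is a primitive of g. *)
Definition is_weak_derivative (a b : R) (u g : R -> R) : Prop :=
  mu.-integrable `[a, b] (EFin \o g) /\
  forall x, x \in `[a, b] -> u x - u a = \int[mu]_(y in `[a, x]) g y.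

(* Determined by u up to a null subset of `[a, b]. *)
Definition weak_derivative (a b : R) (u : R -> R) : R -> R :=
  xget (fun=> 0) [set g | is_weak_derivative a b u g].

(* The Sobolev space H^1_0(]a, b[) = W^{1,2}_0(]a, b[); only the values of u on
   `[a, b] matter. *)
Definition H10 (a b : R) : set (R -> R) :=
  [set u | (exists2 g, is_weak_derivative a b u g &
              mu.-integrable `[a, b] (EFin \o (fun x => g x ^+ 2))) /\
           u a = 0 /\ u b = 0].

Definition W (s : R) : R := (1 - s ^+ 2) ^+ 2 / 4.

Definition energy (eps a b : R) (u : R -> R) : R :=
  \int[mu]_(x in `[a, b])
    (eps / 2 * weak_derivative a b u x ^+ 2 + eps^-1 * W (u x)).

Definition positive_minimizer (eps a b : R) (u : R -> R) : Prop :=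
  [/\ H10 a b u,
      forall x, x \in `]a, b[ -> 0 < u x &
      forall w, H10 a b w -> energy eps a b u <= energy eps a b w].

Definition min_energy (eps a b : R) : R :=
  minimum [set energy eps a b u | u in H10 a b].

(* The circle is R / Z. Points a_0 < ... < a_(n-1) of the circle are given by
   real lifts with a_(n-1) < a_0 + 1, so the complementary arc starting at
   a_i ends at a_(i+1), except the last one, which ends at a_0 + 1. *)
Definition next_node n (a : 'I_n -> R) (i : 'I_n) : R :=
  a (ordS i) + (i.+1 == n)%:R.

Definition BE (eps : R) n (a : 'I_n -> R) : R :=
  \sum_(i < n) min_energy eps (a i) (next_node a i).

(* (-1)^i up(x - i/(2p)) for x in [i/(2p), (i+1)/(2p)[, for every integer i.
   Since 2p is even this is 1-periodic, i.e. a function on the circle. *)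
Definition nodal_solution (p : nat) (up : R -> R) (x : R) : R :=
  let i := Num.floor (x * (2 * p)%:R) in
  (-1) ^ i * up (x - i%:~R / (2 * p)%:R).

Definition node_variation (p : nat) (f : 'I_(2 * p) -> R) (t : R)
    (i : 'I_(2 * p)) : R :=
  i%:R / (2 * p)%:R + t * f i.

Definition has_second_derivative (F : R -> R) (x l : R) : Prop :=
  (\forall t \near x, derivable F t 1) /\ is_derive x (1 : R) (derive1 F) l.

End AllenCahn.

(* Main.v *)
Require Import Defs.
From HB Require Import structures.
From mathcomp Require Import all_boot all_order all_algebra.
From mathcomp Require Import all_classical all_reals all_analysis.
From mathcomp Require Import measurable_realfun ring lra.
Import Order.TTheory GRing.Theory Num.Theory.
Import numFieldNormedType.Exports.
Local Open Scope classical_set_scope.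
Local Open Scope ring_scope.

Set Implicit Arguments.
Unset Strict Implicit.
Unset Printing Implicit Defensive.

(* If U > 0 solves eps^2 U'' = W'(U) on ]a, b[ and vanishes at a and b, then
   Picone's inequality int w'^2 >= int (1 - U^2)/eps^2 w^2 and the identity
   2 w^2 (1 - U^2) + (1 - w^2)^2 = 1 - U^4 + (w^2 - U^2)^2 give
   E(w) >= E(U) + 1/(4 eps) int (w^2 - U^2)^2 for every w in H^1_0. So U is the
   only positive minimizer, and no direct method is needed. Such a U, with
   maximum sqrt k, exists as soon as the length is eps T(k), T = half_period,
   and then E(U) = M(k), M = half_energy. Differentiating under the integral,
   T' > 0 and M' = level T', so that the minimal energy m(L) = M(T^-1(L / eps))
   satisfies m' = level / eps and m'' = - (1 - k) / (2 eps^2 T'(k)) < 0. The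
   broken energy is a sum of values m(1/(2p) + t (f(i+1) - f(i))). *)

(** * Integration on segments *)

(** A competitor [w] in H^1_0 is only a primitive of an L^1 function, so integrating the derivative
    of [w^2 U'/(U + d)] requires a product rule for weak derivatives. As [energy] is computed with a
    chosen weak derivative, almost-everywhere uniqueness is required too. The parameter [k] is the
    squared amplitude, and [level k = W (sqrt k)] is the value of the first integral
    [W u - eps^2 u'^2 / 2]. Thus [m' = level / eps] is the Hamilton-Jacobi relation between minimal
    energy and length, and [m'' < 0] reflects that longer intervals carry larger amplitudes. No
    smallness of [eps] is assumed: the existence of a positive minimizer must itself yield the
    length condition. Picone with a sine gives [L > pi eps], and [pi = T(0)] is the lower end of the
    range of [T] on ]0, 1[. Since [T] reaches every value above [pi], the given minimizer coincides
    on its interval with an explicit profile, whose slope at the node is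
    [c = sqrt (k (1 - k/2)) / eps]. Here [k] depends on [L / eps] only, so [v = m'' / (eps c^2)] is
    a function of [eps] alone. *)

Section segment_integral.
Context {R : realType}.
Local Notation mu := (@lebesgue_measure R).
Local Notation intg a b f := (mu.-integrable `[a, b] (EFin \o f)).
Implicit Types (a b x y : R) (f g h : R -> R).

Lemma within_continuous_bounded a b h : {within `[a, b], continuous h} ->
  [bounded h x | x in `[a, b]].
Proof.
move=> hc; have /compact_bounded [M [Mr hM]] :=
  continuous_compact hc (@segment_compact R a b).
by exists M; split => // N MN x xab; apply: (hM N MN); exists x.
Qed.

Lemma within_continuous_measurable a b h : {within `[a, b], continuous h} ->
  measurable_fun `[a, b] h.
Proof. exact: measurable_realfun.subspace_continuous_measurable_fun. Qed.

Lemma seg_integrable_continuous a b h : {within `[a, b], continuous h} ->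
  intg a b h.
Proof.
by move=> hc; apply: continuous_compact_integrable => //; exact: segment_compact.
Qed.

Lemma seg_integrableM a b g h : intg a b g -> {within `[a, b], continuous h} ->
  intg a b (fun x => g x * h x).
Proof.
move=> ig hc; have := @integrableMl _ _ _ mu `[a, b] _ (EFin \o g) h ig.
apply => //; first exact: within_continuous_measurable.
exact: within_continuous_bounded.
Qed.

Lemma seg_integrableD a b f g : intg a b f -> intg a b g ->
  intg a b (fun x => f x + g x).
Proof. by move=> fi gi; exact: (@integrableD _ _ _ mu `[a, b] (measurable_itv _) (EFin \o f) (EFin \o g) fi gi). Qed.

Lemma seg_integrableB a b f g : intg a b f -> intg a b g ->
  intg a b (fun x => f x - g x).
Proof. by move=> fi gi; exact: (@integrableB _ _ _ mu `[a, b] (measurable_itv _) (EFin \o f) (EFin \o g) fi gi). Qed.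

Lemma seg_integrableZ a b (r : R) f : intg a b f -> intg a b (fun x => r * f x).
Proof. by move=> fi; exact: (@integrableZl _ _ _ mu `[a, b] (measurable_itv _) r (EFin \o f) fi). Qed.

Lemma seg_integrableS a b c d f : a <= c -> d <= b -> intg a b f -> intg c d f.
Proof.
move=> ac db; apply: integrableS => //; apply: subset_itv; by rewrite bnd_simp.
Qed.

Lemma Rintegral_seg_split a b c f : a <= b -> b <= c -> intg a c f ->
  \int[mu]_(t in `[a, c]) f t =
  \int[mu]_(t in `[a, b]) f t + \int[mu]_(t in `[b, c]) f t.
Proof.
move=> ab bc fi; apply/eqP; rewrite addrC -subr_eq; apply/eqP.
rewrite (@Rintegral_itvB _ f (BLeft a) (BRight c) b)//.
rewrite Rintegral_itv_obnd_cbnd//; apply: integrableS fi => //.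
by apply: subset_itv => //; rewrite bnd_simp.
Qed.

Lemma within_continuousP a b h : {within `[a, b], continuous h} <->
  forall x, x \in `[a, b] -> h y @[y --> within `[a, b] (nbhs x)] --> h x.
Proof. by split => /subspace_continuousP. Qed.

Lemma within_cD a b f g : {within `[a, b], continuous f} ->
  {within `[a, b], continuous g} ->
  {within `[a, b], continuous (fun x => f x + g x)}.
Proof.
by rewrite !within_continuousP => cf cg x xab; apply: cvgD; [exact: cf|exact: cg].
Qed.

Lemma within_cB a b f g : {within `[a, b], continuous f} ->
  {within `[a, b], continuous g} ->
  {within `[a, b], continuous (fun x => f x - g x)}.
Proof.
by rewrite !within_continuousP => cf cg x xab; apply: cvgB; [exact: cf|exact: cg].
Qed.

Lemma within_cM a b f g : {within `[a, b], continuous f} ->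
  {within `[a, b], continuous g} ->
  {within `[a, b], continuous (fun x => f x * g x)}.
Proof.
by rewrite !within_continuousP => cf cg x xab; apply: cvgM; [exact: cf|exact: cg].
Qed.

Lemma within_cV a b f : {within `[a, b], continuous f} ->
  (forall x, x \in `[a, b] -> f x != 0) ->
  {within `[a, b], continuous (fun x => (f x)^-1)}.
Proof.
rewrite !within_continuousP => cf f0 x xab; apply: cvgV; [exact: f0|exact: cf].
Qed.

Lemma within_cst a b (c : R) : {within `[a, b], continuous (fun=> c)}.
Proof. by apply/within_continuousP => x _; exact: cvg_cst. Qed.

Lemma within_cX a b f n : {within `[a, b], continuous f} ->
  {within `[a, b], continuous (fun x => f x ^+ n)}.
Proof.
move=> cf; elim: n => [|n ih].
  rewrite (_ : (fun x => _) = fun=> 1); first exact: within_cst.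
  by apply/funext => x; rewrite expr0.
rewrite (_ : (fun x => _) = fun x => f x * f x ^+ n); first exact: within_cM.
by apply/funext => x; rewrite exprS.
Qed.

Lemma within_cS a b c d f : a <= c -> d <= b ->
  {within `[a, b], continuous f} -> {within `[c, d], continuous f}.
Proof.
move=> ac db; apply: continuous_subspaceW.
by apply: subset_itv; rewrite bnd_simp.
Qed.

Lemma within_c_derive a b f f1 :
  (forall x, x \in `[a, b] -> is_derive x (1 : R) f (f1 x)) ->
  {within `[a, b], continuous f}.
Proof.
move=> df; apply: derivable_within_continuous => x xab.
by have [] := df x xab.
Qed.

Lemma Rintegral_FTC2 a b f f1 : a <= b ->
  (forall x, x \in `[a, b] -> is_derive x (1 : R) f (f1 x)) ->
  {within `[a, b], continuous f1} ->
  \int[mu]_(t in `[a, b]) f1 t = f b - f a.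
Proof.
rewrite le_eqVlt => /predU1P[<- _ _|ab df cf1].
  by rewrite set_itv1 Rintegral_set1 subrr.
have cf : forall x, x \in `[a, b] -> f y @[y --> x] --> f x.
  move=> x xab; have [fx _] := df x xab.
  exact/differentiable_continuous/derivable1_diffP.
rewrite /Rintegral (@continuous_FTC2 _ f1 f) //.
- split.
  + by move=> x xab; have [] := df x (subset_itv_oo_cc xab).
  + by apply: cvg_at_right_filter; apply: cf; rewrite /= in_itv/= lexx ltW.
  + by apply: cvg_at_left_filter; apply: cf; rewrite /= in_itv/= lexx ltW.
- move=> x xab; rewrite derive1E.
  by have /(@derive_val _ _ _ _ _ _ _) := df x (subset_itv_oo_cc xab).
Qed.

(** Since [f] is nonnegative, its primitive from [a] vanishes identically, and the derivative of
    that primitive at an interior point is [f x]. *)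
Lemma continuous_ge0_Rintegral0 a b f : {within `[a, b], continuous f} ->
  (forall x, x \in `[a, b] -> 0 <= f x) -> \int[mu]_(t in `[a, b]) f t = 0 ->
  forall x, x \in `]a, b[ -> f x = 0.
Proof.
move=> cf f0 intf x /[dup] xab /=; rewrite in_itv/= => /andP[ax xb].
have fi := seg_integrable_continuous cf.
have int0 y : a <= y -> y <= b -> \int[mu]_(t in `[a, y]) f t = 0.
  move=> ay yb; have := Rintegral_seg_split ay yb fi; rewrite intf => /esym/eqP.
  have h1 : 0 <= \int[mu]_(t in `[a, y]) f t.
    apply: Rintegral_ge0 => t; rewrite /= in_itv/= => /andP[at_ ty].
    by apply: f0; rewrite /= in_itv/= at_ (le_trans ty).
  have h2 : 0 <= \int[mu]_(t in `[y, b]) f t.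
    apply: Rintegral_ge0 => t; rewrite /= in_itv/= => /andP[yt tb].
    by apply: f0; rewrite /= in_itv/= tb (le_trans ay).
  by rewrite paddr_eq0// => /andP[/eqP].
have cfx : {for x, continuous f}.
  have := cf; rewrite (continuous_within_itvP _ (lt_trans ax xb)) => -[+ _ _].
  by apply; exact: xab.
have [dF <-] := continuous_FTC1_closed xb fi ax cfx.
rewrite derive1E.
transitivity ('D_1 (cst (0 : R)) x); last by rewrite derive_cst.
apply: near_eq_derive; near=> y. apply: int0.
- by apply/ltW; near: y; exact: lt_nbhsr.
- by apply/ltW; near: y; exact: lt_nbhsl.
Unshelve. all: by end_near. Qed.

End segment_integral.

(** * Weak derivatives *)

Section weak_derivative.
Context {R : realType}.
Local Notation mu := (@lebesgue_measure R).
Local Notation intg a b f := (mu.-integrable `[a, b] (EFin \o f)).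
Implicit Types (a b x y : R) (f g h p q u w P Q : R -> R).

Lemma is_weak_derivativeB a b u g x y : is_weak_derivative a b u g ->
  a <= x -> x <= y -> y <= b -> u y - u x = \int[mu]_(t in `[x, y]) g t.
Proof.
move=> [gi ug] ax xy yb.
have := ug y; rewrite in_itv/= yb (le_trans ax xy) => /(_ isT).
have := ug x; rewrite in_itv/= ax (le_trans xy yb) => /(_ isT).
rewrite (Rintegral_seg_split ax xy (seg_integrableS (lexx a) yb gi)).
by move=> h1 h2; lra.
Qed.

Lemma is_weak_derivative_continuous a b u g : a <= b ->
  is_weak_derivative a b u g -> {within `[a, b], continuous u}.
Proof.
move=> ab [gi ug]; have := parameterized_integral_continuous ab gi.
rewrite !within_continuousP => cI x xab.
have -> : u x = u a + parameterized_integral mu a x g.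
  by rewrite /parameterized_integral -(ug x xab); ring.
have H : u a + parameterized_integral mu a y g @[y --> within `[a, b] (nbhs x)]
    --> u a + parameterized_integral mu a x g.
  by apply: cvgD; [exact: cvg_cst | exact: cI].
apply: (@cvg_trans _ ((fun y => u a + parameterized_integral mu a y g)
    @ within `[a, b] (nbhs x)) _ _ _ H); apply: near_eq_cvg.
rewrite near_withinE; near=> z => zab /=.
by rewrite /parameterized_integral -(ug z zab); ring.
Unshelve. all: by end_near. Qed.

Lemma is_weak_derivative_C1 a b u u1 :
  (forall x, x \in `[a, b] -> is_derive x (1 : R) u (u1 x)) ->
  {within `[a, b], continuous u1} -> is_weak_derivative a b u u1.
Proof.
move=> du cu1; split; first exact: seg_integrable_continuous.
move=> x /[dup] xab; rewrite in_itv/= => /andP[ax xb].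
apply/esym; apply: Rintegral_FTC2 => //; last exact: within_cS cu1.
move=> t; rewrite in_itv/= => /andP[at_ tx]; apply: du.
by rewrite in_itv/= at_ (le_trans tx).
Qed.

(* The defect D(x, y) of the product rule is additive and at most the square of
   N(x, y) = int_x^y (|p| + |q|). Splitting ]x, y[ where N is halved divides
   this bound by two. *)
Lemma is_weak_derivativeM a b P Q p q : a <= b ->
  is_weak_derivative a b P p -> is_weak_derivative a b Q q ->
  is_weak_derivative a b (fun x => P x * Q x) (fun x => p x * Q x + P x * q x).
Proof.
move=> ab wP wQ.
have cP := is_weak_derivative_continuous ab wP.
have cQ := is_weak_derivative_continuous ab wQ.
have [pi _] := wP; have [qi _] := wQ.
pose g x := p x * Q x + P x * q x.
have gi : intg a b g.
  apply: seg_integrableD; first exact: seg_integrableM.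
  under [X in _.-integrable _ (_ \o X)]eq_fun do rewrite mulrC.
  exact: seg_integrableM.
split=> //.
pose n t := `|p t| + `|q t|.
have ni : intg a b n by apply: seg_integrableD; apply: integrable_norm.
pose N x := \int[mu]_(t in `[a, x]) n t.
pose D x y := P y * Q y - P x * Q x - \int[mu]_(t in `[x, y]) g t.
have NB x y : a <= x -> x <= y -> y <= b ->
    N y - N x = \int[mu]_(t in `[x, y]) n t.
  move=> ax xy yb; rewrite /N (Rintegral_seg_split ax xy); first by ring.
  exact: seg_integrableS ni.
have Nle x y : a <= x -> x <= y -> y <= b -> N x <= N y.
  move=> ax xy yb; rewrite -subr_ge0 NB//.
  by apply: Rintegral_ge0 => t _; rewrite /n addr_ge0.
have incr (U v : R -> R) x y t : is_weak_derivative a b U v ->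
    (forall z, `|v z| <= n z) ->
    a <= x -> y <= b -> x <= t -> t <= y -> `|U y - U t| <= N y - N x /\
    `|U t - U x| <= N y - N x.
  move=> wU vn ax yb xt ty.
  have aux s r : x <= s -> s <= r -> r <= y -> `|U r - U s| <= N y - N x.
    move=> xs sr ry.
    have [vi _] := wU.
    have is_ f : intg a b f -> intg s r f.
      by apply: seg_integrableS; [exact: le_trans xs|exact: le_trans ry yb].
    rewrite (is_weak_derivativeB wU) ?(le_trans ax xs) ?(le_trans ry yb)//.
    apply: le_trans (le_normr_Rintegral _ (is_ _ vi)) _ => //.
    apply: (@le_trans _ _ (\int[mu]_(t in `[s, r]) n t)).
      apply: le_Rintegral => //; last exact: is_.
      by apply: integrable_norm; exact: is_.
    rewrite -NB ?(le_trans ax xs) ?(le_trans ry yb)//.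
    have := Nle _ _ ax xs (le_trans (le_trans sr ry) yb).
    have := Nle _ _ (le_trans ax (le_trans xs sr)) ry yb.
    lra.
  by split; apply: aux => //; exact: le_trans ty.
have D1 x y : a <= x -> x <= y -> y <= b -> `|D x y| <= (N y - N x) ^+ 2.
  move=> ax xy yb.
  have is_ f : intg a b f -> intg x y f by apply: seg_integrableS.
  (* Freezing [Q] at the right end and [P] at the left end makes the discrete product rule exact.
     The integrand is then a sum of two increments times [p] or [q], each increment being at most
     [N y - N x]. *)
  have -> : D x y = \int[mu]_(t in `[x, y]) ((Q y * p t + P x * q t) - g t).
    rewrite RintegralB//; last 2 first.
    - by apply: seg_integrableD; apply: seg_integrableZ; exact: is_.
    - exact: is_.
    rewrite RintegralD//; try by apply: seg_integrableZ; exact: is_.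
    rewrite !RintegralZl//; try exact: is_.
    rewrite -(is_weak_derivativeB wP)// -(is_weak_derivativeB wQ)// /D; ring.
  have ei : intg x y (fun t => (Q y * p t + P x * q t) - g t).
    apply: seg_integrableB; last exact: is_.
    by apply: seg_integrableD; apply: seg_integrableZ; exact: is_.
  apply: le_trans (le_normr_Rintegral _ ei) _ => //.
  rewrite expr2 {2}(NB x y)// -RintegralZl//; last exact: is_.
  apply: le_Rintegral => //.
  - exact: integrable_norm ei.
  - by apply: seg_integrableZ; exact: is_.
  move=> t; rewrite /= in_itv/= => /andP[xt ty].
  have -> : Q y * p t + P x * q t - g t = (Q y - Q t) * p t - (P t - P x) * q t.
    by rewrite /g; ring.
  apply: le_trans (ler_normB _ _) _; rewrite !normrM mulrDr lerD//.
    apply: ler_wpM2r => //.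
    by have [] := incr Q q x y t wQ _ ax yb xt ty => // z; rewrite /n lerDr.
  apply: ler_wpM2r => //.
  by have [] := incr P p x y t wP _ ax yb xt ty => // z; rewrite /n lerDl.
have D2 k x y : a <= x -> x <= y -> y <= b ->
    `|D x y| <= (N y - N x) ^+ 2 / 2 ^+ k.
  elim: k x y => [|k ih] x y ax xy yb; first by rewrite expr0 divr1 D1.
  have cN : {within `[x, y], continuous N}.
    by apply: within_cS (parameterized_integral_continuous ab ni).
  have Nxy := Nle x y ax xy yb.
  have [|z] := @IVT _ N x y ((N x + N y) / 2) xy cN.
    by rewrite (min_idPl Nxy) (max_idPr Nxy); apply/andP; split; lra.
  rewrite in_itv/= => /andP[xz zy] Nz.
  have -> : D x y = D x z + D z y.
    rewrite /D (Rintegral_seg_split xz zy); first by ring.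
    exact: seg_integrableS gi.
  apply: le_trans (ler_normD _ _) _.
  apply: le_trans (lerD (ih x z ax xz (le_trans zy yb))
                        (ih z y (le_trans ax xz) zy yb)) _.
  rewrite Nz (exprS _ k) invfM.
  set d := (2 ^+ k)^-1.
  by rewrite le_eqVlt; apply/orP; left; apply/eqP; field.
move=> x; rewrite in_itv/= => /andP[ax xb].
apply/eqP; rewrite -subr_eq0 -normr_eq0 eq_le normr_ge0 andbT.
apply/ler_addgt0Pr => e e0; rewrite add0r.
have [k ke] : exists k, (N x - N a) ^+ 2 / 2 ^+ k <= e.
  set C := (N x - N a) ^+ 2.
  exists (Num.truncn (C / e)).
  set k := Num.truncn _.
  have h : C / e < k.+1%:R by rewrite truncnS_gt.
  have h2 : k.+1%:R <= 2 ^+ k :> R by rewrite -natrX ler_nat ltn_expl.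
  rewrite ler_pdivrMr ?exprn_gt0// mulrC -ler_pdivrMr//.
  exact: le_trans (ltW h) h2.
exact: le_trans (D2 k a x (lexx a) ax xb) ke.
Qed.

Lemma ae_neq a : {ae mu, forall x, x != a}.
Proof.
exists [set a]; split => //; first exact: lebesgue_measure_set1.
by move=> x /= /negP; rewrite negbK => /eqP.
Qed.

(** The primitive of [g - h] vanishes on the whole segment, and by Lebesgue differentiation its
    derivative is [g - h] almost everywhere. The endpoints, where no two-sided derivative is
    available, form a null set. *)
Lemma is_weak_derivative_ae_unique a b u g h :
  is_weak_derivative a b u g -> is_weak_derivative a b u h ->
  {ae mu, forall x, x \in `[a, b] -> g x = h x}.
Proof.
move=> [gi ug] [hi uh].
pose f x := g x - h x.
have fi : intg a b f by exact: seg_integrableB.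
(* Lebesgue differentiation asks for local integrability on the whole line, hence the extension by
   zero. *)
pose f0 := f \_ `[a, b].
have f0i : intg a b f0.
  by rewrite -restrict_EFin; apply/integrable_restrict => //=; rewrite setIidr.
have f0E x : x \in `[a, b] -> f0 x = f x by move=> xab; rewrite /f0 patchE mem_set.
have int0 x : x \in `[a, b] -> \int[mu]_(t in `[a, x]) f0 t = 0.
  move=> /[dup] xab; rewrite in_itv/= => /andP[ax xb].
  rewrite (@eq_Rintegral _ _ _ mu _ f) => [|t]; last first.
    rewrite inE/= in_itv/= => /andP[at_ tx].
    by apply: f0E; rewrite in_itv/= at_ (le_trans tx).
  rewrite RintegralB//.
  - by rewrite -ug// -uh// subrr.
  - exact: seg_integrableS gi.
  - exact: seg_integrableS hi.
have loc := integrable_locally (measurable_itv `[a, b]) fi.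
apply: (@filterS3 _ _ (ae_filter_ringOfSetsType mu) _ _ _ _ _
  (lebesgue_differentiation loc) (ae_neq a) (ae_neq b)).
move=> x fx xa xb /[dup] xab; rewrite in_itv/= => /andP[ax bx].
have {}ax : a < x by rewrite lt_neqAle eq_sym xa.
have {}bx : x < b by rewrite lt_neqAle xb.
have [dF] := @FTC1_lebesgue_pt _ f0 (BLeft a) x b bx f0i ax fx.
rewrite f0E// => F1; apply/eqP; rewrite -subr_eq0 -/(f x) -F1 derive1E.
apply/eqP; transitivity ('D_1 (cst (0 : R)) x); last by rewrite derive_cst.
apply: near_eq_derive; near=> y; apply: int0.
by rewrite in_itv/=; apply/andP; split; apply/ltW; near: y;
  [exact: lt_nbhsr|exact: lt_nbhsl].
Unshelve. all: by end_near. Qed.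
End weak_derivative.

(** * Picone's inequality *)

Section pointwise_derivatives.
Context {R : realType}.
Implicit Types (f g : R -> R) (x df dg : R).

Lemma der1M f g x df dg : is_derive x (1 : R) f df -> is_derive x (1 : R) g dg ->
  is_derive x (1 : R) (fun y => f y * g y) (df * g x + f x * dg).
Proof.
move=> hf hg; have [h1 h2] := is_deriveM hf hg.
by split=> //; rewrite h2 /GRing.scale /=; ring.
Qed.

Lemma der1D f g x df dg : is_derive x (1 : R) f df -> is_derive x (1 : R) g dg ->
  is_derive x (1 : R) (fun y => f y + g y) (df + dg).
Proof. by move=> hf hg; exact: (@is_deriveD _ _ _ f g). Qed.

Lemma der1B f g x df dg : is_derive x (1 : R) f df -> is_derive x (1 : R) g dg ->
  is_derive x (1 : R) (fun y => f y - g y) (df - dg).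
Proof. by move=> hf hg; exact: (@is_deriveB _ _ _ f g). Qed.

Lemma der1Z f x (k : R) df : is_derive x (1 : R) f df ->
  is_derive x (1 : R) (fun y => k * f y) (k * df).
Proof. by move=> hf; exact: (@is_deriveZ _ _ _ f). Qed.

Lemma der1V f x df : is_derive x (1 : R) f df -> f x != 0 ->
  is_derive x (1 : R) (fun y => (f y)^-1) (- df / f x ^+ 2).
Proof.
move=> hf f0; have [h1 h2] := is_deriveV f0 hf.
by split=> //; rewrite h2 /GRing.scale /= !mulNr mulrC.
Qed.

Lemma der1_comp f g x df dg : is_derive (g x) (1 : R) f df ->
  is_derive x (1 : R) g dg -> is_derive x (1 : R) (fun y => f (g y)) (df * dg).
Proof. by move=> hf hg; exact: (@is_derive1_comp _ f g). Qed.

Lemma der1_cst x (c : R) : is_derive x (1 : R) (fun=> c) 0.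
Proof. exact: is_derive_cst. Qed.

Lemma der1_eq f x df dg : is_derive x (1 : R) f df -> df = dg ->
  is_derive x (1 : R) f dg.
Proof. by move=> hf <-. Qed.

Lemma is_derive1_continuous f x df : is_derive x (1 : R) f df ->
  {for x, continuous f}.
Proof.
by move=> [fx _]; exact/differentiable_continuous/derivable1_diffP.
Qed.
End pointwise_derivatives.

Section picone.
Context {R : realType}.
Local Notation mu := (@lebesgue_measure R).
Local Notation intg a b f := (mu.-integrable `[a, b] (EFin \o f)).
Implicit Types (a b x y : R) (f g h k p q u w P Q U : R -> R).

(** Membership in [H10] only provides some weak derivative with integrable square; almost-everywhere
    uniqueness carries this over to the chosen one. *)
Lemma H10_weak_derivative a b w (g := weak_derivative a b w) : H10 a b w ->
  [/\ is_weak_derivative a b w g, intg a b (fun x => g x ^+ 2),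
      w a = 0 & w b = 0].
Proof.
move=> [[g0 wg0 g0i] [wa wb]].
have wg : is_weak_derivative a b w g by apply: xgetPex; exists g0.
split=> //; apply/integrableP.
have /integrableP[/measurable_EFinP mg _] := wg.1.
have mg2 : measurable_fun `[a, b] (EFin \o (fun x => g x ^+ 2)).
  by apply/measurable_EFinP; exact: measurable_funX.
split => //.
have /integrableP[mg0 fin] := g0i.
rewrite (_ : (\int[mu]_(x in `[a, b]) `|(g x ^+ 2)%:E|)%E =
  (\int[mu]_(x in `[a, b]) `|(g0 x ^+ 2)%:E|)%E) //.
apply: ae_eq_integral => //; try exact: measurableT_comp.
apply: (@filterS _ _ (ae_filter_ringOfSetsType mu)) (is_weak_derivative_ae_unique wg wg0).
by move=> x gg xab /=; rewrite gg.
Qed.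

(* Integrate (w' - w z)^2 >= 0 with z = U'/(U + d), which solves the Riccati
   equation z' = U''/(U + d) - z^2. *)
Lemma picone_shift a b w g U U1 U2 (d : R) : a <= b -> 0 < d ->
  is_weak_derivative a b w g -> intg a b (fun x => g x ^+ 2) ->
  w a = 0 -> w b = 0 ->
  (forall x, x \in `[a, b] -> 0 <= U x) ->
  (forall x, x \in `[a, b] -> is_derive x (1 : R) U (U1 x)) ->
  (forall x, x \in `[a, b] -> is_derive x (1 : R) U1 (U2 x)) ->
  {within `[a, b], continuous U2} ->
  - (\int[mu]_(x in `[a, b]) (w x ^+ 2 * (U2 x / (U x + d)))) <=
  \int[mu]_(x in `[a, b]) g x ^+ 2.
Proof.
move=> ab d0 wg g2 wa wb U0 dU dU1 cU2.
have Ud x : x \in `[a, b] -> U x + d != 0.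
  by move=> xab; rewrite gt_eqF// ltr_wpDl// U0.
pose z x := U1 x / (U x + d).
pose z1 x := U2 x / (U x + d) - z x ^+ 2.
have dz x : x \in `[a, b] -> is_derive x (1 : R) z (z1 x).
  move=> xab; have dUd : is_derive x (1 : R) (fun y => U y + d) (U1 x).
      by apply: der1_eq (der1D (dU x xab) (der1_cst _ d)) _; rewrite addr0.
  rewrite /z. apply: der1_eq (der1M (dU1 x xab) (der1V dUd (Ud x xab))) _.
  by rewrite /z1 /z; field; exact: Ud.
have cU : {within `[a, b], continuous U} by exact: within_c_derive dU.
have cV : {within `[a, b], continuous (fun x => (U x + d)^-1)}.
  by apply: within_cV => //; apply: within_cD => //; exact: within_cst.
have cz : {within `[a, b], continuous z} by exact: within_c_derive dz.
have cq : {within `[a, b], continuous (fun x => U2 x / (U x + d))}.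
  exact: within_cM.
have cz1 : {within `[a, b], continuous z1} by apply: within_cB => //; exact: within_cX.
have cw := is_weak_derivative_continuous ab wg.
have wz := is_weak_derivative_C1 dz cz1.
(* [F] is the derivative of [w^2 z]. It integrates to 0 because [w] vanishes at both ends. *)
have [wwi] := is_weak_derivativeM ab (is_weak_derivativeM ab wg wg) wz.
move=> /(_ b); rewrite in_itv/= ab lexx wa wb !mul0r subrr => /(_ isT) int0.
set F := (fun x => _) in wwi int0.
have qi : intg a b (fun x => w x ^+ 2 * (U2 x / (U x + d))).
  by apply: seg_integrable_continuous; apply: within_cM => //; exact: within_cX.
have sq0 : 0 <= \int[mu]_(x in `[a, b]) (g x - w x * z x) ^+ 2.
  by apply: Rintegral_ge0 => x _; exact: sqr_ge0.
have e : \int[mu]_(x in `[a, b]) (g x - w x * z x) ^+ 2 =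
    \int[mu]_(x in `[a, b]) (g x ^+ 2 + w x ^+ 2 * (U2 x / (U x + d)) - F x).
  by apply: eq_Rintegral => x _; rewrite /F /z1; ring.
move: sq0; rewrite e RintegralB//; last exact: seg_integrableD.
rewrite RintegralD// -[X in _ - X]int0; lra.
Qed.

(** [U] may vanish at the ends, where [U'/U] is singular. The shifts [d = 1/(n+1)] avoid this, and
    dominated convergence removes them: [U/(U + d)] lies in [0, 1] and tends to 1 wherever
    [U > 0]. *)
Lemma picone a b w g U U1 k : a <= b ->
  is_weak_derivative a b w g -> intg a b (fun x => g x ^+ 2) ->
  w a = 0 -> w b = 0 ->
  (forall x, x \in `[a, b] -> 0 <= U x) ->
  (forall x, x \in `]a, b[ -> 0 < U x) ->
  {within `[a, b], continuous k} ->
  (forall x, x \in `[a, b] -> is_derive x (1 : R) U (U1 x)) ->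
  (forall x, x \in `[a, b] -> is_derive x (1 : R) U1 (- (k x * U x))) ->
  \int[mu]_(x in `[a, b]) (k x * w x ^+ 2) <=
  \int[mu]_(x in `[a, b]) g x ^+ 2.
Proof.
move=> ab wg g2 wa wb U0 Up ck dU dU1.
have cU : {within `[a, b], continuous U} by exact: within_c_derive dU.
have cw := is_weak_derivative_continuous ab wg.
pose f n x := k x * w x ^+ 2 * (U x / (U x + n.+1%:R^-1)).
have n0 n : (0 : R) < n.+1%:R^-1 by rewrite invr_gt0.
have Ud n x : x \in `[a, b] -> 0 < U x + n.+1%:R^-1.
  by move=> xab; rewrite ltr_wpDl// U0.
have ckw : {within `[a, b], continuous (fun x => k x * w x ^+ 2)}.
  by apply: within_cM => //; exact: within_cX.
have cf n : {within `[a, b], continuous (f n)}.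
  apply: within_cM => //; apply: within_cM => //; apply: within_cV.
    by apply: within_cD => //; exact: within_cst.
  by move=> x xab; rewrite gt_eqF// Ud.
have le n : \int[mu]_(x in `[a, b]) f n x <= \int[mu]_(x in `[a, b]) g x ^+ 2.
  have cU2 : {within `[a, b], continuous (fun x => - (k x * U x))}.
    rewrite (_ : (fun x => _) = fun x => (- 1) * (k x * U x)); last first.
      by apply/funext => x; rewrite mulN1r.
    by apply: within_cM; [exact: within_cst|exact: within_cM].
  apply: le_trans (picone_shift ab (n0 n) wg g2 wa wb U0 dU dU1 cU2).
  rewrite -mulN1r -RintegralZl//; last first.
    apply: seg_integrable_continuous; apply: within_cM; first exact: within_cX.
    apply: within_cM => //; apply: within_cV.
      by apply: within_cD => //; exact: within_cst.
    by move=> x xab; rewrite gt_eqF// Ud.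
  rewrite le_eqVlt; apply/orP; left; apply/eqP/eq_Rintegral => x _.
  by rewrite /f; ring.
have cvg : (\int[mu]_(x in `[a, b]) (f n x)%:E)%E @[n --> \oo] -->
    (\int[mu]_(x in `[a, b]) (k x * w x ^+ 2)%:E)%E.
  apply: (@dominated_cvg _ _ _ mu _ _ _ _
      (EFin \o (fun x => `|k x * w x ^+ 2|))) => //.
  - by move=> n; apply/measurable_EFinP; exact: within_continuous_measurable.
  - move=> x /= xab; apply: cvg_EFin; first exact: nearW.
    rewrite /comp /=.
    (* At the endpoints the ratio need not tend to 1, but there the factor [w x ^+ 2] is 0. *)
    have [xab'|] := boolP (x \in `]a, b[); last first.
      move: xab; rewrite !in_itv/= => /andP[ax xb] nab.
      have w0 : w x = 0.
        move: ax; rewrite le_eqVlt => /predU1P[<-//|ax].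
        by move: xb nab; rewrite le_eqVlt ax => /predU1P[->//|->].
      rewrite /f w0 expr0n/= mulr0.
      rewrite (_ : (fun n => _) = fun=> 0); first exact: cvg_cst.
      by apply/funext => n; rewrite mul0r.
    rewrite -[X in _ --> X]mulr1; apply: cvgM; first exact: cvg_cst.
    rewrite -[X in _ --> X](@divff _ (U x)) ?gt_eqF ?Up//.
    apply: cvgM; first exact: cvg_cst.
    apply: cvgV; first by rewrite gt_eqF// Up.
    rewrite -[X in _ --> X]addr0; apply: cvgD; first exact: cvg_cst.
    exact: (@cvg_harmonic R).
  - have := integrable_norm (seg_integrable_continuous ckw).
    by [].
  - move=> n x /= xab; rewrite lee_fin /f normrM ler_piMr//.
    rewrite ger0_norm ?divr_ge0 ?U0// ?(ltW (Ud _ _ _))//.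
    by rewrite ler_pdivrMr ?Ud// mul1r lerDl ltW.
have ki := seg_integrable_continuous ckw.
have fin : (\int[mu]_(x in `[a, b]) (k x * w x ^+ 2)%:E)%E =
    (\int[mu]_(x in `[a, b]) (k x * w x ^+ 2))%:E.
  by rewrite /Rintegral fineK//; exact: integrable_fin_num.
rewrite fin in cvg.
apply: (cvgr_to_le (fine_cvg cvg)); apply: nearW => n; exact: le.
Qed.
End picone.

(** * Minimizers *)

Section minimizers.
Context {R : realType}.
Local Notation mu := (@lebesgue_measure R).
Local Notation intg a b f := (mu.-integrable `[a, b] (EFin \o f)).
Implicit Types (a b x y : R) (f g h k p q u w P Q U : R -> R).

(** This frees [energy] from the choice made by [weak_derivative]: explicit derivatives can be used
    from here on. *)
Lemma energyE (eps : R) a b w g : a <= b -> H10 a b w ->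
  is_weak_derivative a b w g ->
  energy eps a b w = eps / 2 * (\int[mu]_(x in `[a, b]) (g x ^+ 2)) +
    eps^-1 * (\int[mu]_(x in `[a, b]) W (w x)).
Proof.
move=> ab Hw wg; have [wd d2 _ _] := H10_weak_derivative Hw.
rewrite /energy; move: (weak_derivative a b w) wd d2 => d wd d2.
have cw := is_weak_derivative_continuous ab wg.
have Wi : intg a b (fun x => W (w x)).
  apply: seg_integrable_continuous; rewrite /W.
  apply: within_cM; last exact: within_cst.
  by apply: within_cX; apply: within_cB; [exact: within_cst|exact: within_cX].
rewrite RintegralD//; [|exact: seg_integrableZ..].
rewrite !RintegralZl//; congr (_ * _ + _).
have ae1 := is_weak_derivative_ae_unique wd wg.
rewrite /Rintegral; congr fine; apply: ae_eq_integral => //.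
- by case/integrableP : d2.
- have /integrableP[/measurable_EFinP mg _] := wg.1.
  by apply/measurable_EFinP; exact: measurable_funX.
- apply: (@filterS _ _ (ae_filter_ringOfSetsType mu)) ae1.
  by move=> x e xab /=; rewrite e.
Qed.

Lemma H10_C1 a b U U1 : U a = 0 -> U b = 0 ->
  (forall x, x \in `[a, b] -> is_derive x (1 : R) U (U1 x)) ->
  {within `[a, b], continuous U1} -> H10 a b U.
Proof.
move=> Ua Ub dU cU1; split=> //; exists U1; first exact: is_weak_derivative_C1.
by apply: seg_integrable_continuous; exact: within_cX.
Qed.

(** The coefficient [k] is left free for two uses: [(1 - U^2) / eps^2] for a critical point, and a
    constant eigenvalue with a sine for the bound on the length. *)
Lemma energy_ge_picone (eps : R) a b w U U1 k : 0 < eps -> a <= b ->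
  H10 a b w ->
  (forall x, x \in `[a, b] -> 0 <= U x) ->
  (forall x, x \in `]a, b[ -> 0 < U x) ->
  {within `[a, b], continuous k} ->
  (forall x, x \in `[a, b] -> is_derive x (1 : R) U (U1 x)) ->
  (forall x, x \in `[a, b] -> is_derive x (1 : R) U1 (- (k x * U x))) ->
  \int[mu]_(x in `[a, b]) (eps / 2 * (k x * w x ^+ 2) + eps^-1 * W (w x)) <=
  energy eps a b w.
Proof.
move=> eps0 ab Hw U0 Up ck dU dU1.
have [wg g2 wa wb] := H10_weak_derivative Hw.
rewrite (energyE _ ab Hw wg).
have cw := is_weak_derivative_continuous ab wg.
have Wi : intg a b (fun x => W (w x)).
  apply: seg_integrable_continuous; rewrite /W.
  apply: within_cM; last exact: within_cst.
  by apply: within_cX; apply: within_cB; [exact: within_cst|exact: within_cX].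
have ki : intg a b (fun x => k x * w x ^+ 2).
  by apply: seg_integrable_continuous; apply: within_cM => //; exact: within_cX.
rewrite RintegralD//; [|exact: seg_integrableZ..].
rewrite !RintegralZl// lerD2r; apply: ler_wpM2l.
  by rewrite divr_ge0// ltW.
exact: picone wg g2 wa wb U0 Up ck dU dU1.
Qed.

(** * Energy comparison with a positive critical point *)

Section critical_point.
Variables (eps a b : R) (U U1 : R -> R).
Hypothesis eps_gt0 : 0 < eps.
Hypothesis ab : a < b.
Hypothesis U_pos : forall x, x \in `]a, b[ -> 0 < U x.
Hypothesis Ua : U a = 0.
Hypothesis Ub : U b = 0.
Hypothesis dU : forall x, x \in `[a, b] -> is_derive x (1 : R) U (U1 x).
Hypothesis dU1 : forall x, x \in `[a, b] ->
  is_derive x (1 : R) U1 (- ((1 - U x ^+ 2) / eps ^+ 2 * U x)).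

Let U_ge0 x : x \in `[a, b] -> 0 <= U x.
Proof.
rewrite in_itv/= !le_eqVlt => /andP[/predU1P[<-|ax] /predU1P[->|xb]];
  rewrite ?Ua ?Ub ?eqxx//.
by rewrite U_pos ?orbT// in_itv/= ax.
Qed.

Let cU : {within `[a, b], continuous U}.
Proof. exact: within_c_derive dU. Qed.

Let cU1 : {within `[a, b], continuous U1}.
Proof. exact: within_c_derive dU1. Qed.

Lemma critical_H10 : H10 a b U.
Proof. exact: H10_C1 cU1. Qed.

Let m := \int[mu]_(x in `[a, b]) ((1 - U x ^+ 4) / (4 * eps)).

(** Testing the equation with [U] itself turns [int U1^2] into [int (1 - U^2) U^2 / eps^2]; the
    integrand then collapses to [(1 - U^4) / (4 eps)]. *)
Lemma critical_energy : energy eps a b U = m.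
Proof.
rewrite (energyE _ (ltW ab) critical_H10 (is_weak_derivative_C1 dU cU1)).
pose k x := (1 - U x ^+ 2) / eps ^+ 2.
have ck : {within `[a, b], continuous k}.
  apply: within_cM; last exact: within_cst.
  by apply: within_cB; [exact: within_cst|exact: within_cX].
have U12i : intg a b (fun x => U1 x ^+ 2).
  by apply: seg_integrable_continuous; exact: within_cX.
have kUi : intg a b (fun x => k x * U x ^+ 2).
  by apply: seg_integrable_continuous; apply: within_cM => //; exact: within_cX.
have -> : \int[mu]_(x in `[a, b]) (U1 x ^+ 2) =
    \int[mu]_(x in `[a, b]) (k x * U x ^+ 2).
  apply/eqP; rewrite -subr_eq0 -RintegralB//; apply/eqP.
  transitivity (U b * U1 b - U a * U1 a); last by rewrite Ua Ub !mul0r subrr.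
  apply: (@Rintegral_FTC2 _ _ _ (fun x => U x * U1 x)); first exact: ltW.
    move=> x xab; apply: der1_eq (der1M (dU xab) (dU1 xab)) _.
    by rewrite /k; ring.
  apply: within_cB; first exact: within_cX.
  by apply: within_cM => //; exact: within_cX.
have Wi : intg a b (fun x => W (U x)).
  apply: seg_integrable_continuous; rewrite /W.
  apply: within_cM; last exact: within_cst.
  by apply: within_cX; apply: within_cB; [exact: within_cst|exact: within_cX].
rewrite -!RintegralZl// -RintegralD//; [|exact: seg_integrableZ..].
apply: eq_Rintegral => x _; rewrite /k /W; field.
by rewrite gt_eqF.
Qed.

(* The energy is convex as a function of w^2, which makes the defect a square. *)
Lemma critical_energy_le w : H10 a b w ->
  energy eps a b U +
    (4 * eps)^-1 * (\int[mu]_(x in `[a, b]) ((w x ^+ 2 - U x ^+ 2) ^+ 2)) <=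
  energy eps a b w.
Proof.
move=> Hw.
have [wg _ _ _] := H10_weak_derivative Hw.
have cw := is_weak_derivative_continuous (ltW ab) wg.
pose k x := (1 - U x ^+ 2) / eps ^+ 2.
have ck : {within `[a, b], continuous k}.
  apply: within_cM; last exact: within_cst.
  by apply: within_cB; [exact: within_cst|exact: within_cX].
apply: le_trans (@energy_ge_picone _ _ _ _ U U1 k eps_gt0 (ltW ab) Hw U_ge0 U_pos ck dU dU1).
have sqi : intg a b (fun x => (w x ^+ 2 - U x ^+ 2) ^+ 2).
  apply: seg_integrable_continuous; apply: within_cX.
  by apply: within_cB; exact: within_cX.
have mi : intg a b (fun x => (1 - U x ^+ 4) / (4 * eps)).
  apply: seg_integrable_continuous; apply: within_cM; last exact: within_cst.
  by apply: within_cB; [exact: within_cst|exact: within_cX].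
rewrite critical_energy /m -RintegralZl// -RintegralD//; last exact: seg_integrableZ.
rewrite le_eqVlt; apply/orP; left; apply/eqP/eq_Rintegral => x _.
by rewrite /k /W; field; rewrite gt_eqF.
Qed.

Lemma critical_min_energy : min_energy eps a b = m.
Proof.
rewrite /min_energy /minimum.
have lb : lbound [set energy eps a b u | u in H10 a b] m.
  move=> _ [w Hw <-]; apply: le_trans (critical_energy_le Hw).
  rewrite critical_energy lerDl mulr_ge0//.
    by rewrite invr_ge0 mulr_ge0// ltW.
  by apply: Rintegral_ge0 => x _; exact: sqr_ge0.
have mem : [set energy eps a b u | u in H10 a b] m.
  by exists U; [exact: critical_H10|exact: critical_energy].
set S := [set e | _].
have [Sx lbx] : S (xget 0 S) by apply: xgetPex; exists m.
by apply/eqP; rewrite eq_le lbx// lb.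
Qed.

(** Comparing [u] and [U] in both directions forces the square defect to vanish, so [u^2 = U^2]
    inside the interval, and positivity fixes the sign. *)
Lemma positive_minimizer_unique u : positive_minimizer eps a b u ->
  forall x, x \in `[a, b] -> u x = U x.
Proof.
move=> [Hu up umin] x xab.
have [wg _ ua ub] := H10_weak_derivative Hu.
have cu := is_weak_derivative_continuous (ltW ab) wg.
have [xab'|] := boolP (x \in `]a, b[); last first.
  move: xab; rewrite !in_itv/= => /andP[ax xb] nab.
  move: ax; rewrite le_eqVlt => /predU1P[<-|ax]; first by rewrite ua.
  by move: xb nab; rewrite le_eqVlt ax => /predU1P[->|->//]; rewrite ub.
have csq : {within `[a, b], continuous (fun x => (u x ^+ 2 - U x ^+ 2) ^+ 2)}.
  by apply: within_cX; apply: within_cB; exact: within_cX.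
have int0 : \int[mu]_(x in `[a, b]) ((u x ^+ 2 - U x ^+ 2) ^+ 2) = 0.
  apply/eqP; rewrite eq_le Rintegral_ge0 ?andbT; last by move=> t _; exact: sqr_ge0.
  have := le_trans (critical_energy_le Hu) (umin _ critical_H10).
  by rewrite gerDl pmulr_rle0// invr_gt0 mulr_gt0.
have := continuous_ge0_Rintegral0 csq (fun t _ => sqr_ge0 _) int0 xab'.
move/eqP; rewrite sqrf_eq0 subr_eq0 eqrXn2// => [/eqP//||]; last exact: ltW (U_pos _).
exact: ltW (up _ _).
Qed.

End critical_point.

(** If [b - a <= pi eps], the first Dirichlet eigenvalue [r^2 = (pi / (b - a))^2] is at least
    [1 / eps^2]. The Poincare inequality, which is Picone with a sine, then gives
    [E(u) >= E(0) + 1/(4 eps) int u^4], so a minimizer would have to vanish. *)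
Lemma positive_minimizer_length (eps : R) a b u : 0 < eps -> a < b ->
  positive_minimizer eps a b u -> pi * eps < b - a.
Proof.
move=> eps0 ab [Hu up umin]; rewrite ltNge; apply/negP => Lpi.
have L0 : 0 < b - a by rewrite subr_gt0.
have [wg _ ua ub] := H10_weak_derivative Hu.
have cu := is_weak_derivative_continuous (ltW ab) wg.
pose r : R := pi / (b - a).
have rL : r * (b - a) = pi by rewrite /r mulfVK// gt_eqF.
have r0 : 0 < r by rewrite divr_gt0// pi_gt0.
have reps : 1 <= (r * eps) ^+ 2.
  apply: exprn_ege1; have -> : r * eps = pi * eps / (b - a) by rewrite /r; ring.
  by rewrite ler_pdivlMr// mul1r.
pose U x := sin (r * (x - a)).
pose U1 x := r * cos (r * (x - a)).
have daff x : is_derive x (1 : R) (fun x => r * (x - a)) r.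
  apply: der1_eq (der1Z r (der1B (is_derive_id x (1 : R)) (der1_cst x a))) _.
  by rewrite subr0 mulr1.
have dU x : x \in `[a, b] -> is_derive x (1 : R) U (U1 x).
  move=> _; apply: der1_eq (der1_comp (is_derive_sin _) (daff x)) _.
  by rewrite /U1 mulrC.
have dU1 x : x \in `[a, b] -> is_derive x (1 : R) U1 (- (r ^+ 2 * U x)).
  move=> _; apply: der1_eq (der1Z r (der1_comp (is_derive_cos _) (daff x))) _.
  by rewrite /U; ring.
have Up x : x \in `]a, b[ -> 0 < U x.
  rewrite in_itv/= => /andP[ax xb]; apply: sin_gt0_pi.
  rewrite mulr_gt0 ?subr_gt0//= -rL ltr_pM2l// ltrD2r//.
have U0 x : x \in `[a, b] -> 0 <= U x.
  rewrite in_itv/= => /andP[ax xb]; apply: sin_ge0_pi.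
  rewrite mulr_ge0 ?subr_ge0// ?(ltW r0)//= -rL ler_pM2l// lerD2r//.
have := @energy_ge_picone eps a b u U U1 (fun=> r ^+ 2) eps0 (ltW ab) Hu U0 Up
  (@within_cst _ a b _) dU dU1.
have H0 : H10 a b (fun=> 0).
  by apply: (@H10_C1 _ _ _ (fun=> 0)) => //; exact: within_cst.
have wd0 : is_weak_derivative a b (fun=> 0) (fun=> 0 : R).
  by apply: is_weak_derivative_C1; exact: within_cst.
move=> /le_trans /(_ (umin _ H0)); rewrite (energyE _ (ltW ab) H0 wd0).
have ci (c : R) : intg a b (fun=> c).
  by apply: seg_integrable_continuous; exact: within_cst.
have u4i : intg a b (fun x => u x ^+ 4).
  by apply: seg_integrable_continuous; exact: within_cX.
have -> : eps / 2 * (\int[mu]_(x in `[a, b]) (0 ^+ 2 : R)) +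
    eps^-1 * (\int[mu]_(x in `[a, b]) W (0 : R)) =
    \int[mu]_(x in `[a, b]) (4 * eps)^-1.
  rewrite -!RintegralZl// -RintegralD//; [|exact: seg_integrableZ..].
  by apply: eq_Rintegral => x _; rewrite /W; field; rewrite gt_eqF.
have : \int[mu]_(x in `[a, b]) ((4 * eps)^-1 + (4 * eps)^-1 * u x ^+ 4) <=
  \int[mu]_(x in `[a, b]) (eps / 2 * (r ^+ 2 * u x ^+ 2) + eps^-1 * W (u x)).
  apply: le_Rintegral => //.
  - by apply: seg_integrableD => //; exact: seg_integrableZ.
  - apply: seg_integrable_continuous; apply: within_cD.
      apply: within_cM; first exact: within_cst.
      by apply: within_cM; [exact: within_cst|exact: within_cX].
    rewrite /W; apply: within_cM; first exact: within_cst.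
    apply: within_cM; last exact: within_cst.
    by apply: within_cX; apply: within_cB; [exact: within_cst|exact: within_cX].
  move=> x _; rewrite -subr_ge0.
  have -> : eps / 2 * (r ^+ 2 * u x ^+ 2) + eps^-1 * W (u x) -
    ((4 * eps)^-1 + (4 * eps)^-1 * u x ^+ 4) =
    ((r * eps) ^+ 2 - 1) * u x ^+ 2 / (2 * eps).
    by rewrite /W; field; rewrite gt_eqF.
  apply: divr_ge0; last by rewrite mulr_ge0// ltW.
  by apply: mulr_ge0; [rewrite subr_ge0|exact: sqr_ge0].
move=> /le_trans/[apply].
rewrite RintegralD//; last exact: seg_integrableZ.
rewrite gerDl RintegralZl// pmulr_rle0 ?invr_gt0 ?mulr_gt0// => int_le0.
have u4 : {within `[a, b], continuous (fun x => u x ^+ 4)} by exact: within_cX.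
have u40 x : x \in `[a, b] -> 0 <= u x ^+ 4 by move=> _; rewrite exprn_even_ge0.
have int0 : \int[mu]_(x in `[a, b]) (u x ^+ 4) = 0.
  by apply/eqP; rewrite eq_le int_le0 Rintegral_ge0.
have mid : (a + b) / 2 \in `]a, b[ by rewrite in_itv/=; apply/andP; split; lra.
have := continuous_ge0_Rintegral0 u4 u40 int0 mid.
by move/eqP; rewrite expf_eq0/= gt_eqF// up.
Qed.

End minimizers.

(** * Positive solutions with zero boundary values *)

Section local_inverse.
Context {R : realType}.
Implicit Types (f g : R -> R) (x y : R).

Lemma derive_pos_increasing f (f1 : R -> R) (al be : R) :
  (forall x, x \in `]al, be[ -> is_derive x (1 : R) f (f1 x)) ->
  (forall x, x \in `]al, be[ -> 0 < f1 x) ->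
  forall x y, x \in `]al, be[ -> y \in `]al, be[ -> x < y -> f x < f y.
Proof.
move=> df f1p x y; rewrite !in_itv/= => /andP[ax xb] /andP[ay yb] xy.
have sub z : x <= z -> z <= y -> z \in `]al, be[.
  by move=> xz zy; rewrite in_itv/= (lt_le_trans ax xz) (le_lt_trans zy yb).
have dfxy z : z \in `[x, y] -> is_derive z (1 : R) f (f1 z).
  by rewrite in_itv/= => /andP[xz zy]; exact: df (sub _ xz zy).
have cf := within_c_derive dfxy.
have [c] := @MVT R f f1 x y xy (fun z zI => dfxy z (subset_itv_oo_cc zI)) cf.
rewrite in_itv/= => /andP[xc cy] e; rewrite -subr_gt0 e mulr_gt0 ?subr_gt0//.
by apply: f1p; apply: sub; exact: ltW.
Qed.

(** Used for the time as a function of the angle and for the half period as a function of [k]. The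
    last clause makes [g] a genuine right inverse on a neighbourhood, which is needed to vary the
    lengths of the arcs. *)
Lemma increasing_inverse f (f1 : R -> R) (al be : R) :
  (forall x, x \in `]al, be[ -> is_derive x (1 : R) f (f1 x)) ->
  (forall x, x \in `]al, be[ -> 0 < f1 x) ->
  exists g, forall x, x \in `]al, be[ ->
    g (f x) = x /\ is_derive (f x) (1 : R) g (f1 x)^-1 /\
    \forall y \near f x, f (g y) = y /\ g y \in `]al, be[.
Proof.
move=> df f1p; have finc := derive_pos_increasing df f1p.
pose g y := xget 0 [set x | (x \in `]al, be[) /\ f x = y].
have gK x : x \in `]al, be[ -> g (f x) = x.
  move=> xab; rewrite /g.
  have [] : [set z | (z \in `]al, be[) /\ f z = f x] (g (f x)).
    by apply: xgetPex; exists x.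
  rewrite -/(g (f x)); set z := g (f x) => zab fz.
  by have [/(finc _ _ zab xab)|/(finc _ _ xab zab)|//] := ltgtP z x; rewrite fz ltxx.
exists g => x xab.
have nx : \forall z \near x, z \in `]al, be[ by exact: near_in_itvoo.
have fgK : {near x, cancel f g} by near=> z; apply: gK; near: z.
have fc : {near x, continuous f}.
  by apply: filterS nx => z zab; exact: is_derive1_continuous (df z zab).
have dg : is_derive (f x) (1 : R) g (f1 x)^-1.
  by apply: (is_derive_inverse fgK fc (df x xab)); rewrite gt_eqF// f1p.
split; first exact: gK.
split=> //; have [_ gfK] := near_can_continuousAcan_sym fgK fc.
have gc := is_derive1_continuous dg.
near=> y; split; first by near: y.
near: y; have := gc; rewrite /prop_for /continuous_at gK// => h.
exact: (h _ nx).
Unshelve. all: by end_near. Qed.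

End local_inverse.

(** * Pendulum parametrization of the positive solutions *)

Section profile.
Context {R : realType}.
Local Notation mu := (@lebesgue_measure R).
Local Notation intg a b f := (mu.-integrable `[a, b] (EFin \o f)).
Implicit Types (a b x y t k : R).

(* With s = sin t, the pendulum substitution u = sqrt k * s turns the first
   integral eps^2 u'^2 / 2 = W u - W (sqrt k) into eps t' = speed k t. *)
Definition speed2 k t : R := 1 - k * ((1 + sin t ^+ 2) / 2).
Definition speed k t : R := Num.sqrt (speed2 k t).
(** This is [W (sqrt k)], the value of the first integral, read off at the maximum of [u]. *)
Definition level k : R := (1 - k) ^+ 2 / 4.
(** The distance between consecutive zeros in units of [eps]: a complete elliptic integral of the
    first kind, [2 K / sqrt (1 - k/2)] with squared modulus [k / (2 - k)]. *)
Definition half_period k : R := \int[mu]_(t in `[0, pi]) (speed k t)^-1.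
(** By the first integral the energy density is [eps u'^2 + level k / eps]; substituting
    [u' = sqrt k cos t * speed / eps] and [dx = eps / speed dt] gives this form. *)
Definition arc_energy k t : R :=
  k * (cos t ^+ 2 * speed k t) + level k * (speed k t)^-1.
Definition half_energy k : R := \int[mu]_(t in `[0, pi]) arc_energy k t.

Lemma sin2_le1 t : sin t ^+ 2 <= 1 :> R.
Proof. by have := cos2Dsin2 t; have := sqr_ge0 (cos t); lra. Qed.

Lemma speed2_ge k t : 0 <= k -> 1 - k <= speed2 k t.
Proof.
move=> k0; rewrite /speed2 lerD2l lerN2 ler_piMr//.
by have := sin2_le1 t; lra.
Qed.

Lemma speed2_gt0 k t : k < 1 -> 0 < speed2 k t.
Proof.
move=> k1; have [k0|k0] := leP 0 k.
  by apply: lt_le_trans (speed2_ge t k0); rewrite subr_gt0.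
rewrite /speed2; have : k * ((1 + sin t ^+ 2) / 2) <= 0.
  by rewrite mulr_le0_ge0 ?(ltW k0)// divr_ge0// addr_ge0// sqr_ge0.
lra.
Qed.

Lemma speed_gt0 k t : k < 1 -> 0 < speed k t.
Proof. by move=> k1; rewrite sqrtr_gt0 speed2_gt0. Qed.

Lemma speed_neq0 k t : k < 1 -> speed k t != 0.
Proof. by move=> k1; rewrite gt_eqF// speed_gt0. Qed.

Lemma sqr_speed k t : k < 1 -> speed k t ^+ 2 = speed2 k t.
Proof. by move=> k1; rewrite sqr_sqrtr// ltW// speed2_gt0. Qed.

Lemma is_derive_speed_t k t : k < 1 ->
  is_derive t (1 : R) (speed k) (- (k * (sin t * cos t)) / (2 * speed k t)).
Proof.
move=> k1.
have d2 : is_derive t (1 : R) (speed2 k) (- (k * (sin t * cos t))).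
  have ds := is_derive_sin t.
  have := der1B (der1_cst t 1) (der1Z k (der1M
    (der1D (der1_cst t 1) (der1M ds ds)) (der1_cst t (2^-1)))).
  by move=> h; apply: der1_eq h _; field.
apply: der1_eq (der1_comp (is_derive1_sqrt (speed2_gt0 t k1)) d2) _.
by rewrite mulrC.
Qed.

Lemma is_derive_speed_k k t : k < 1 -> is_derive k (1 : R) (fun k => speed k t)
  (- ((1 + sin t ^+ 2) / 2) / (2 * speed k t)).
Proof.
move=> k1.
have d2 : is_derive k (1 : R) (fun k => speed2 k t) (- ((1 + sin t ^+ 2) / 2)).
  have := der1B (der1_cst k 1) (der1M (is_derive_id k (1 : R))
    (der1_cst k ((1 + sin t ^+ 2) / 2))).
  by move=> h; apply: der1_eq h _; rewrite mulr0 addr0 mul1r sub0r.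
have h := @der1_comp _ Num.sqrt (fun k => speed2 k t) k _ _
  (is_derive1_sqrt (speed2_gt0 t k1)) d2.
apply: der1_eq h _.
by rewrite mulrC.
Qed.

Lemma continuous_speed k : k < 1 -> continuous (speed k).
Proof. by move=> k1 t; exact: is_derive1_continuous (is_derive_speed_t t k1). Qed.

Lemma within_speed a b k : k < 1 -> {within `[a, b], continuous (speed k)}.
Proof. by move=> k1; apply: continuous_subspaceT; exact: continuous_speed. Qed.

Lemma within_speedV a b k : k < 1 ->
  {within `[a, b], continuous (fun t => (speed k t)^-1)}.
Proof.
by move=> k1; apply: within_cV => [|t _]; [exact: within_speed|exact: speed_neq0].
Qed.

Lemma within_sin a b : {within `[a, b], continuous (@sin R)}.
Proof. by apply: continuous_subspaceT; exact: continuous_sin. Qed.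

Lemma within_cos a b : {within `[a, b], continuous (@cos R)}.
Proof. by apply: continuous_subspaceT; exact: continuous_cos. Qed.

Lemma within_arc_energy a b k : k < 1 ->
  {within `[a, b], continuous (arc_energy k)}.
Proof.
move=> k1; apply: within_cD; apply: within_cM; try exact: within_cst.
- by apply: within_cM; [apply: within_cX; exact: within_cos|exact: within_speed].
- exact: within_speedV.
Qed.

(* A primitive on a neighbourhood of `[0, pi], as needed for two-sided
   derivatives at 0 and pi. *)
Lemma primitive_segment (h : R -> R) :
  (forall a b, {within `[a, b], continuous h}) ->
  exists2 H : R -> R, H 0 = 0 /\ H pi = \int[mu]_(t in `[0, pi]) h t &
    forall x, x \in `](-1), (pi + 1)[ -> is_derive x (1 : R) H (h x).
Proof.
move=> ch; have hi a b : intg a b h by exact: seg_integrable_continuous.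
pose H x := (\int[mu]_(t in `[-1, x]) h t) - (\int[mu]_(t in `[-1, 0]) h t).
have pi0 := @pi_ge0 R.
exists H; first split.
- by rewrite /H subrr.
- rewrite /H (@Rintegral_seg_split _ (-1) 0 pi)//.
  by rewrite addrAC subrr add0r.
move=> x /[dup] xI; rewrite in_itv/= => /andP[x1 x2].
have chx : {for x, continuous h}.
  have := ch (-1) (pi + 1); rewrite continuous_within_itvP; last exact: lt_trans x2.
  by move=> [+ _ _]; apply.
have [d1 d2] := continuous_FTC1_closed x2 (hi _ _) x1 chx.
have dI : is_derive x (1 : R) (fun y => \int[mu]_(t in `[-1, y]) h t) (h x).
  by apply: DeriveDef; [exact: d1|rewrite -derive1E; exact: d2].
by apply: der1_eq (der1B dI (der1_cst x _)) _; rewrite subr0.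
Qed.

(** The position as a function of the angle is [a + eps X(t)], where [X' = 1 / speed]. Inverting [X]
    yields the angle [p], and [U = sqrt k * sin p]. The hypothesis on [b - a] says exactly that [p]
    runs from 0 to [pi]. *)
Lemma profile_exists k (eps a b : R) : 0 < k -> k < 1 -> 0 < eps ->
  b - a = eps * half_period k ->
  exists U U1 : R -> R,
  [/\ forall x, x \in `]a, b[ -> 0 < U x, U a = 0 & U b = 0] /\
  [/\ forall x, x \in `[a, b] -> is_derive x (1 : R) U (U1 x),
      forall x, x \in `[a, b] ->
        is_derive x (1 : R) U1 (- ((1 - U x ^+ 2) / eps ^+ 2 * U x)),
      U1 a = Num.sqrt (k * (1 - k / 2)) / eps, U1 b = - U1 a &
      \int[mu]_(x in `[a, b]) (eps / 2 * U1 x ^+ 2 + eps^-1 * W (U x)) =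
      half_energy k].
Proof.
move=> k0 k1 eps0 abT.
have [X [X0 Xpi] dX] := primitive_segment (fun x y => @within_speedV x y k k1).
have [A [A0 Api] dA] := primitive_segment (fun x y => @within_arc_energy x y k k1).
have Xp x : x \in `](-1), (pi + 1)[ -> 0 < (speed k x)^-1.
  by move=> _; rewrite invr_gt0 speed_gt0.
have [psi psiP] := increasing_inverse dX Xp.
have Xinc := derive_pos_increasing dX Xp.
have pi0 := @pi_gt0 R.
have sub t : t \in `[0, pi] -> t \in `](-1), (pi + 1)[.
  by rewrite !in_itv/= => /andP[t0 tpi]; apply/andP; split; lra.
have I0 : (0 : R) \in `](-1), (pi + 1)[ by apply: sub; rewrite in_itv/= lexx ltW.
have Ipi : (pi : R) \in `](-1), (pi + 1)[ by apply: sub; rewrite in_itv/= lexx ltW.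
have cX : {within `[0, pi], continuous X}.
  exact: within_c_derive (fun t tI => dX t (sub t tI)).
pose p x := psi ((x - a) / eps).
have T0 : 0 < half_period k.
  by rewrite /half_period -Xpi -X0; exact: Xinc.
have ab : a < b by rewrite -subr_gt0 abT mulr_gt0.
have pP x : x \in `[a, b] ->
    [/\ p x \in `[0, pi], X (p x) = (x - a) / eps &
      is_derive x (1 : R) p (speed k (p x) / eps)].
  rewrite in_itv/= => /andP[ax xb].
  have y0 : 0 <= (x - a) / eps by rewrite divr_ge0 ?subr_ge0// ltW.
  have yT : (x - a) / eps <= half_period k.
    by rewrite ler_pdivrMr// mulrC -abT lerD2r.
  have [|t tI Xt] := @IVT R X 0 pi ((x - a) / eps) (ltW pi0) cX.
    rewrite X0 Xpi -/(half_period k) (min_idPl (ltW T0)) (max_idPr (ltW T0)).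
    by rewrite y0.
  have [psit [dpsi _]] := psiP t (sub t tI).
  have px : p x = t by rewrite /p -Xt.
  rewrite px; split=> //.
  have daff : is_derive x (1 : R) (fun x => (x - a) / eps) eps^-1.
    apply: der1_eq (der1M (der1B (is_derive_id x (1 : R)) (der1_cst x a))
      (der1_cst x eps^-1)) _.
    by rewrite subr0 mul1r mulr0 addr0.
  move: dpsi; rewrite Xt invrK => dpsi.
  exact: (@der1_comp _ psi (fun x => (x - a) / eps) x _ _ dpsi daff).
have pa : p a = 0.
  by have [psi0 _] := psiP 0 I0; rewrite /p subrr mul0r -X0 psi0.
have pb : p b = pi.
  have [psipi _] := psiP pi Ipi.
  by rewrite /p abT mulrAC mulfV ?gt_eqF// mul1r /half_period -Xpi psipi.
pose q := Num.sqrt k.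
have q2 : q ^+ 2 = k by rewrite sqr_sqrtr// ltW.
have q0 : 0 < q by rewrite sqrtr_gt0.
pose U x := q * sin (p x).
pose U1 x := q * (cos (p x) * speed k (p x)) / eps.
have epsn0 : eps != 0 by rewrite gt_eqF.
have dU x : x \in `[a, b] -> is_derive x (1 : R) U (U1 x).
  move=> xab; have [_ _ dp] := pP x xab.
  apply: der1_eq (der1Z q (der1_comp (is_derive_sin _) dp)) _.
  by rewrite /U1; ring.
have dU1 x : x \in `[a, b] ->
    is_derive x (1 : R) U1 (- ((1 - U x ^+ 2) / eps ^+ 2 * U x)).
  move=> xab; have [_ _ dp] := pP x xab.
  have h := der1M (der1Z q (der1M (der1_comp (is_derive_cos _) dp)
    (der1_comp (is_derive_speed_t _ k1) dp))) (der1_cst x eps^-1).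
  apply: der1_eq h _.
  rewrite /U exprMn q2; set S := speed k (p x).
  have Sn0 : S != 0 by exact: speed_neq0.
  have S2 : S ^+ 2 = 1 - k * ((1 + sin (p x) ^+ 2) / 2) by exact: sqr_speed.
  have c2 : cos (p x) ^+ 2 = 1 - sin (p x) ^+ 2.
    by have := cos2Dsin2 (p x); lra.
  set s := sin (p x) in S2 c2 *; set c := cos (p x) in c2 *.
  (* In this form the equation reduces to [S^2 + k c^2 / 2 = 1 - k s^2], and [k s^2] is [U^2]. *)
  have -> : q * (- s * (S / eps) * S + c * (- (k * (s * c)) / (2 * S) * (S / eps)))
      / eps + q * (c * S) * 0 = - (q * s * (S ^+ 2 + k * c ^+ 2 / 2)) / eps ^+ 2.
    by field; rewrite epsn0 Sn0.
  by rewrite S2 c2; field.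
exists U, U1; split; first split.
- move=> x xab; have xab' := subset_itv_oo_cc xab.
  have [] := pP x xab'; rewrite in_itv/= => /andP[p0 ppi] Xp_ _.
  move: xab; rewrite in_itv/= => /andP[ax xb].
  apply: mulr_gt0 => //; apply: sin_gt0_pi; rewrite !lt_neqAle p0 ppi !andbT.
  have xE : x - a = eps * X (p x) by rewrite Xp_ mulrC divfK.
  apply/andP; split; apply/eqP => e; move: xE.
    by rewrite -e X0 mulr0 => ?; lra.
  by rewrite e Xpi -/(half_period k) -abT => ?; lra.
- by rewrite /U pa sin0 mulr0.
- by rewrite /U pb sinpi mulr0.
split=> //.
- rewrite /U1 pa cos0 mul1r /q /speed /speed2 sin0 expr0n/= addr0 mul1r.
  by rewrite -sqrtrM// ltW.
- by rewrite /U1 pa pb cos0 cospi /speed /speed2 sin0 sinpi; ring.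
have -> : half_energy k = A (p b) - A (p a) by rewrite pa pb A0 Api subr0.
have dAp x : x \in `[a, b] -> is_derive x (1 : R) (fun x => A (p x))
    (eps / 2 * U1 x ^+ 2 + eps^-1 * W (U x)).
  move=> xab; have [pI _ dp] := pP x xab.
  apply: der1_eq (der1_comp (dA _ (sub _ pI)) dp) _.
  rewrite /arc_energy /U1 /U /W /level !exprMn q2; set S := speed k (p x).
  have Sn0 : S != 0 by exact: speed_neq0.
  have S2 : S ^+ 2 = 1 - k * ((1 + sin (p x) ^+ 2) / 2) by exact: sqr_speed.
  have c2 : cos (p x) ^+ 2 = 1 - sin (p x) ^+ 2.
    by have := cos2Dsin2 (p x); lra.
  set s := sin (p x) in S2 c2 *; set c := cos (p x) in c2 *.
  have -> : (k * (c ^+ 2 * S) + (1 - k) ^+ 2 / 4 * S^-1) * (S / eps) =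
    (k * (c ^+ 2 * S ^+ 2) + (1 - k) ^+ 2 / 4) / eps by field; rewrite epsn0 Sn0.
  by rewrite S2 c2; field.
have cU : {within `[a, b], continuous U} by exact: within_c_derive dU.
have cU1 : {within `[a, b], continuous U1} by exact: within_c_derive dU1.
apply: (Rintegral_FTC2 (ltW ab) dAp).
apply: within_cD; apply: within_cM; try exact: within_cst.
  exact: within_cX.
rewrite /W; apply: within_cM; last exact: within_cst.
by apply: within_cX; apply: within_cB; [exact: within_cst|exact: within_cX].
Qed.

End profile.

(** * Half period and energy as functions of the amplitude *)

Section half_period_derivatives.
Context {R : realType}.
Local Notation mu := (@lebesgue_measure R).
Local Notation intg a b f := (mu.-integrable `[a, b] (EFin \o f)).
Implicit Types (a b x y t k : R).

Lemma is_derive_Rintegral (F F' : R -> R -> R) (u v k C a b : R) :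
  k \in `]u, v[ ->
  (forall x, x \in `]u, v[ -> {within `[a, b], continuous (F x)}) ->
  (forall x t, x \in `]u, v[ -> t \in `[a, b] ->
    is_derive x (1 : R) (fun x => F x t) (F' x t)) ->
  (forall x t, x \in `]u, v[ -> t \in `[a, b] -> `|F' x t| <= C) ->
  is_derive k (1 : R) (fun x => \int[mu]_(t in `[a, b]) F x t)
    (\int[mu]_(t in `[a, b]) F' k t).
Proof.
move=> kuv cF dF bF.
have d1E x t : x \in `]u, v[ -> t \in `[a, b] -> partial1of2 F x t = F' x t.
  move=> xuv tab; rewrite /partial1of2 derive1E.
  by have [_ ->] := dF x t xuv tab.
have := @cvg_differentiation_under_integral R _ _ mu F `[a, b]
  (measurable_itv _) k u v kuv _ _ (fun=> `|C|) _ _ _.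
have h1 x : `]u, v[%classic x -> intg a b (F x).
  by move=> xuv; apply: seg_integrable_continuous; exact: cF.
have h2 x t : `]u, v[%classic x -> `[a, b]%classic t -> derivable (F^~ t) x 1.
  by move=> xuv tab; have [] := dF x t xuv tab.
have h3 : intg a b (fun=> `|C|).
  by apply: seg_integrable_continuous; exact: within_cst.
have h4 x t : `]u, v[%classic x -> `[a, b]%classic t ->
    `|partial1of2 F x t| <= `|C|.
  move=> xuv tab; rewrite d1E//; apply: le_trans (bF x t xuv tab) _.
  exact: ler_norm.
move=> /(_ h1 h2 (fun=> normr_ge0 _) h3 h4).
rewrite (@eq_Rintegral _ _ _ mu _ (F' k) (partial1of2 F k)); last first.
  by move=> t /set_mem tab; apply: d1E.
set G := fun x => \int[mu]_(t in `[a, b]) F x t => cvgG.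
suff cvgG' : h^-1 *: ((G \o shift k) (h *: 1) - G k) @[h --> 0^'] -->
    \int[mu]_(t in `[a, b]) F' k t.
  apply: DeriveDef; first by apply/cvg_ex; eexists; exact: cvgG'.
  exact: (cvg_lim _ cvgG').
by under eq_fun do rewrite /= /GRing.scale /= mulr1.
Qed.

(** Minus the [k]-derivative of [speed2 k t]. *)
Definition sweep t : R := (1 + sin t ^+ 2) / 2.

Definition half_period' k : R :=
  \int[mu]_(t in `[0, pi]) (sweep t / (2 * speed k t ^+ 3)).

Lemma sweep_ge t : 1 / 2 <= sweep t.
Proof. by rewrite /sweep; have := sqr_ge0 (sin t : R); lra. Qed.

Lemma sweep_ge0 t : 0 <= sweep t.
Proof. by have := sweep_ge t; lra. Qed.

Lemma sweep_le1 t : sweep t <= 1.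
Proof. by rewrite /sweep; have := sin2_le1 t; lra. Qed.

Lemma within_sweep a b : {within `[a, b], continuous sweep}.
Proof.
apply: within_cM; last exact: within_cst.
by apply: within_cD; [exact: within_cst|apply: within_cX; exact: within_sin].
Qed.

Lemma speed_le1 k t : 0 <= k -> k < 1 -> speed k t <= 1.
Proof.
move=> k0 k1; rewrite -sqrtr1 ler_wsqrtr// /speed2 gerBl mulr_ge0//.
exact: sweep_ge0.
Qed.

Lemma speed_ge (v k t : R) : 0 <= v -> v < 1 -> k < v ->
  Num.sqrt (1 - v) <= speed k t.
Proof.
move=> v0 v1 kv; apply: ler_wsqrtr; have [k0|k0] := leP 0 k.
  by apply: le_trans (speed2_ge t k0); lra.
have : k * ((1 + sin t ^+ 2) / 2) <= 0.
  by rewrite mulr_le0_ge0 ?(ltW k0)//; exact: sweep_ge0.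
rewrite /speed2; lra.
Qed.

(** The midpoint [v] of [|k|] and 1 leaves room above [k] while [speed] stays above [sqrt (1 - v)],
    which provides the constant dominating bounds. *)
Let bound k (v := (1 + `|k|) / 2) : -1 < k -> k < 1 ->
  [/\ k \in `](-1), v[, 0 <= v, v < 1 & 0 < Num.sqrt (1 - v)].
Proof.
move=> km1 k1; have kn : `|k| < 1 by rewrite ltr_norml km1.
have := ler_norm k; have := normr_ge0 k; rewrite sqrtr_gt0 in_itv/= km1 /v => ? ?.
by split; lra.
Qed.

(** Negative [k] have no meaning as squared amplitudes, but they make the derivative two-sided at 0,
    where the intermediate value argument for surjectivity starts. *)
Lemma is_derive_half_period k : -1 < k -> k < 1 ->
  is_derive k (1 : R) half_period (half_period' k).
Proof.
move=> km1 k1; have [kI v0 v1 s0] := bound km1 k1.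
set v := (1 + `|k|) / 2 in kI v0 v1 s0.
set s := Num.sqrt (1 - v) in s0.
apply: (@is_derive_Rintegral (fun k t => (speed k t)^-1)
  (fun k t => sweep t / (2 * speed k t ^+ 3)) (-1) v k (2 * s ^+ 3)^-1) => //.
- by move=> x; rewrite in_itv/= => /andP[_ xv]; apply: within_speedV; exact: lt_trans v1.
- move=> x t; rewrite in_itv/= => /andP[_ xv] _; have x1 := lt_trans xv v1.
  apply: der1_eq (der1V (is_derive_speed_k t x1) (speed_neq0 t x1)) _.
  by rewrite /sweep; field; exact: speed_neq0.
- move=> x t; rewrite in_itv/= => /andP[_ xv] _; have x1 := lt_trans xv v1.
  have S0 := speed_gt0 t x1; have sS := speed_ge t v0 v1 xv.
  have b0 := sweep_ge0 t.
  rewrite ger0_norm; last first.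
    by apply: divr_ge0; [exact: b0|rewrite mulr_ge0// exprn_ge0// ltW].
  rewrite -[leRHS]mul1r; apply: ler_pM => //.
  - by rewrite invr_ge0 mulr_ge0// exprn_ge0// ltW.
  - exact: sweep_le1.
  - rewrite lef_pV2 ?posrE ?mulr_gt0 ?exprn_gt0// ler_pM2l//.
    by rewrite lerXn2r// nnegrE ltW.
Qed.

(** The integrand is at least 1/4, since [sweep >= 1/2] and [speed <= 1]. *)
Lemma half_period'_gt0 k : 0 <= k -> k < 1 -> 0 < half_period' k.
Proof.
move=> k0 k1; have pi0 := @pi_gt0 R.
apply: (@lt_le_trans _ _ (\int[mu]_(t in `[0, pi]) (4^-1))).
  rewrite Rintegral_cst//= lebesgue_measure_itv/= lte_fin pi0 oppr0 addr0.
  by rewrite mulr_gt0.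
apply: le_Rintegral => //.
- by apply: seg_integrable_continuous; exact: within_cst.
- apply: seg_integrable_continuous; apply: within_cM; first exact: within_sweep.
  apply: within_cV => [|t _].
    by apply: within_cM; [exact: within_cst|apply: within_cX; exact: within_speed].
  by rewrite mulf_neq0// expf_neq0// speed_neq0.
move=> t _; have S0 := speed_gt0 t k1.
have S3 : speed k t ^+ 3 <= 1.
  by apply: exprn_ile1; [exact: ltW|exact: speed_le1].
have S30 : 0 < speed k t ^+ 3 by rewrite exprn_gt0.
rewrite ler_pdivlMr ?mulr_gt0//; have := sweep_ge t; lra.
Qed.

Let cos_energy k : R := \int[mu]_(t in `[0, pi]) (cos t ^+ 2 * speed k t).

Let is_derive_cos_energy k : -1 < k -> k < 1 ->
  is_derive k (1 : R) cos_energy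
    (\int[mu]_(t in `[0, pi]) (cos t ^+ 2 * (- sweep t / (2 * speed k t)))).
Proof.
move=> km1 k1; have [kI v0 v1 s0] := bound km1 k1.
set v := (1 + `|k|) / 2 in kI v0 v1 s0.
set s := Num.sqrt (1 - v) in s0.
apply: (@is_derive_Rintegral (fun k t => cos t ^+ 2 * speed k t)
  (fun k t => cos t ^+ 2 * (- sweep t / (2 * speed k t))) (-1) v k (2 * s)^-1) => //.
- move=> x; rewrite in_itv/= => /andP[_ xv]; apply: within_cM.
    by apply: within_cX; exact: within_cos.
  by apply: within_speed; exact: lt_trans v1.
- move=> x t; rewrite in_itv/= => /andP[_ xv] _; have x1 := lt_trans xv v1.
  exact: (der1Z (cos t ^+ 2) (is_derive_speed_k t x1)).
- move=> x t; rewrite in_itv/= => /andP[_ xv] _; have x1 := lt_trans xv v1.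
  have S0 := speed_gt0 t x1; have sS := speed_ge t v0 v1 xv.
  have b0 := sweep_ge0 t.
  have c1 : cos t ^+ 2 <= 1 :> R.
    by have := cos2Dsin2 t; have := sqr_ge0 (sin t); lra.
  rewrite mulNr mulrN normrN mulrA ger0_norm; last first.
    apply: divr_ge0; first by apply: mulr_ge0; [exact: sqr_ge0|exact: b0].
    by rewrite mulr_ge0// ltW.
  rewrite -[leRHS]mul1r; apply: ler_pM => //.
  - by apply: mulr_ge0; [exact: sqr_ge0|exact: b0].
  - by rewrite invr_ge0 mulr_ge0// ltW.
  - by rewrite mulr_ile1 ?sqr_ge0// sweep_le1.
  - by rewrite lef_pV2 ?posrE ?mulr_gt0// ler_pM2l.
Qed.

(* Up to the derivative of sin t cos t (speed k t) / 2, which integrates to 0,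
   the k-derivative of the integrand of half_energy is level k times that of
   the integrand of half_period. *)
Lemma is_derive_half_energy k : -1 < k -> k < 1 ->
  is_derive k (1 : R) half_energy (level k * half_period' k).
Proof.
move=> km1 k1; have pi0 := @pi_ge0 R.
have cS := @within_speed R 0 pi k k1.
have cSV := @within_speedV R 0 pi k k1.
have ccos := @within_cos R 0 pi.
have csin := @within_sin R 0 pi.
(* Splitting the integral needs [x < 1] for integrability, so the identity is stated near [k]
   only. *)
have hE : \forall x \near k, x * cos_energy x + level x * half_period x =
    half_energy x.
  near=> x; have x1 : x < 1 by near: x; exact: lt_nbhsl.
  rewrite /half_energy /arc_energy RintegralD//; last 2 first.
  - apply: seg_integrableZ; apply: seg_integrable_continuous.
    by apply: within_cM; [apply: within_cX; exact: within_cos|exact: within_speed].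
  - by apply: seg_integrableZ; apply: seg_integrable_continuous; exact: within_speedV.
  rewrite !RintegralZl//.
  - by apply: seg_integrable_continuous; exact: within_speedV.
  - apply: seg_integrable_continuous.
    by apply: within_cM; [apply: within_cX; exact: within_cos|exact: within_speed].
have dlevel : is_derive k (1 : R) level (- (1 - k) / 2).
  have d1 := der1B (der1_cst k 1) (is_derive_id k (1 : R)).
  by apply: der1_eq (der1M (der1M d1 d1) (der1_cst k 4^-1)) _; field.
have d := der1D (der1M (is_derive_id k (1 : R)) (is_derive_cos_energy km1 k1))
  (der1M dlevel (is_derive_half_period km1 k1)).
have {}d := near_eq_is_derive hE d.
apply: der1_eq d _.
rewrite mul1r addrA -[RHS]add0r; congr (_ + _).
have i1 : intg 0 pi (fun t => cos t ^+ 2 * speed k t).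
  by apply: seg_integrable_continuous; apply: within_cM => //; exact: within_cX.
have c2 : {within `[0, pi], continuous
    (fun t : R => cos t ^+ 2 * (- sweep t / (2 * speed k t)))}.
  apply: within_cM; first exact: within_cX.
  apply: within_cM.
    rewrite (_ : (fun t => - sweep t) = fun t => (-1) * sweep t).
      by apply: within_cM; [exact: within_cst|exact: within_sweep].
    by apply/funext => t; rewrite mulN1r.
  apply: within_cV => [|t _]; last by rewrite mulf_neq0// speed_neq0.
  by apply: within_cM => //; exact: within_cst.
have i2 := seg_integrable_continuous c2.
have i3 := seg_integrable_continuous cSV.
have j1 := seg_integrableZ k i2.
have j2 := seg_integrableZ (- (1 - k) / 2) i3.
have j12 := seg_integrableD i1 j1.
rewrite /cos_energy /half_period -!RintegralZl// -RintegralD// -RintegralD//.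
pose q t : R := sin t * cos t * speed k t / 2.
have dq t : t \in `[0, pi] -> is_derive t (1 : R) q (cos t ^+ 2 * speed k t +
    k * (cos t ^+ 2 * (- sweep t / (2 * speed k t))) +
    - (1 - k) / 2 * (speed k t)^-1).
  move=> _; have h := der1M (der1M (der1M (is_derive_sin t) (is_derive_cos t))
    (is_derive_speed_t t k1)) (der1_cst t 2^-1).
  apply: der1_eq h _.
  have Sn0 := speed_neq0 t k1; have := sqr_speed t k1; rewrite /speed2 /sweep.
  have := cos2Dsin2 t; move: (speed k t) Sn0 => S Sn0 cs S2.
  have {cs}c2 : cos t ^+ 2 = 1 - sin t ^+ 2 by lra.
  move: (sin t) (cos t) c2 S2 => s c c2 S2.
  transitivity (((c ^+ 2 - s ^+ 2) * S ^+ 2 - k * s ^+ 2 * c ^+ 2 / 2) / (2 * S)).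
    by field.
  rewrite [RHS](_ : _ = (2 * c ^+ 2 * S ^+ 2 - k * c ^+ 2 * (1 + s ^+ 2) / 2 -
    (1 - k)) / (2 * S)); last by field.
  by congr (_ / _); rewrite S2 c2; field.
rewrite (@Rintegral_FTC2 _ 0 pi q _ pi0 dq).
  by rewrite /q sinpi sin0 !mul0r subrr.
apply: within_cD; last by apply: within_cM => //; exact: within_cst.
apply: within_cD; last by apply: within_cM => //; exact: within_cst.
by apply: within_cM => //; exact: within_cX.
Unshelve. all: by end_near. Qed.

(* Near pi/2, speed k t <= sqrt (1 - k) + |t - pi/2|. *)
Lemma half_period_unbounded (B : R) : 0 < B ->
  exists2 k, 0 < k < 1 & B <= half_period k.
Proof.
(* With [sqrt (1 - k) = e], the integral of [1 / (e + pi/2 - t)] over [0, pi/2] is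
   [ln (e + pi/2) - ln e], and [- ln e = B]. *)
move=> B0; pose e : R := expR (- B).
have e0 : 0 < e by exact: expR_gt0.
have e1 : e < 1 by rewrite expR_lt1 oppr_lt0.
have e21 : e ^+ 2 < 1 by rewrite exprn_ilt1// ltW.
have e20 : 0 < e ^+ 2 by rewrite exprn_gt0.
exists (1 - e ^+ 2); first by apply/andP; split; lra.
set k := 1 - e ^+ 2; have k1 : k < 1 by rewrite /k; lra.
have k0 : 0 <= k by rewrite /k; lra.
have pi2 := @pihalf_ge1 R.
pose d t : R := e + (pi / 2 - t).
have dgt0 t : t \in `[0, pi / 2] -> 0 < d t.
  by rewrite in_itv/= => /andP[t0 tp]; rewrite /d; lra.
have cd : {within `[0, pi / 2], continuous d}.
  apply: within_cD; first exact: within_cst.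
  apply: within_cB; first exact: within_cst.
  by apply: continuous_subspaceT => x; exact: cvg_id.
have cdV : {within `[0, pi / 2], continuous (fun t => (d t)^-1)}.
  by apply: within_cV => // t tI; rewrite gt_eqF// dgt0.
have dl t : t \in `[0, pi / 2] -> is_derive t (1 : R) (fun t => - ln (d t)) (d t)^-1.
  move=> tI; have dd : is_derive t (1 : R) d (-1).
    apply: der1_eq (der1D (der1_cst t e) (der1B (der1_cst t (pi / 2))
      (is_derive_id t (1 : R)))) _.
    by rewrite add0r sub0r.
  have h := @der1_comp _ (@ln R) d t _ _ (is_derive1_ln (dgt0 t tI)) dd.
  have := @is_deriveN _ _ _ _ t 1 _ h; rewrite mulrN1 opprK.
  exact.
have int1 : \int[mu]_(t in `[0, pi / 2]) (d t)^-1 = ln (e + pi / 2) + B.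
  rewrite (@Rintegral_FTC2 _ 0 (pi / 2) _ _ _ dl cdV); last by lra.
  by rewrite /d subrr addr0 subr0 /e expRK; ring.
have ln0 : 0 <= ln (e + pi / 2) by rewrite ln_ge0//; lra.
have p0 : 0 <= pi / 2 :> R by lra.
have p1 : pi / 2 <= pi :> R by lra.
have iV a b := seg_integrable_continuous (@within_speedV R a b k k1).
rewrite /half_period (Rintegral_seg_split p0 p1 (iV _ _)).
have ge0 : 0 <= \int[mu]_(t in `[pi / 2, pi]) (speed k t)^-1.
  by apply: Rintegral_ge0 => t _; rewrite invr_ge0 ltW// speed_gt0.
suff : \int[mu]_(t in `[0, pi / 2]) (d t)^-1 <=
    \int[mu]_(t in `[0, pi / 2]) (speed k t)^-1.
  by rewrite int1 => h; apply: le_trans (lerD h ge0); rewrite addr0 lerDr.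
apply: le_Rintegral => //; first exact: seg_integrable_continuous.
move=> t /[dup] tI; rewrite /= in_itv/= => /andP[t0 tp].
have d0 := dgt0 t tI.
rewrite lef_pV2 ?posrE ?speed_gt0//.
rewrite -(ger0_norm (ltW d0)) -sqrtr_sqr ler_wsqrtr//.
have cos_le : 0 <= cos t <= pi / 2 - t.
  apply/andP; split.
    by apply: cos_ge0_pihalf; apply/andP; split; lra.
  have [c cI] := @MVT_segment R cos (fun t => - sin t) t (pi / 2) tp
    (fun x _ => is_derive_cos x) (@within_cos R t (pi / 2)).
  rewrite cos_pihalf => cE.
  have := sin_le1 c; have := sin_le1 c.
  have : (sin c) * (pi / 2 - t) <= 1 * (pi / 2 - t).
    by apply: ler_wpM2r; [lra|exact: sin_le1].
  lra.
case/andP: cos_le => c0 cle.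
have c2 : cos t ^+ 2 <= (pi / 2 - t) ^+ 2 by rewrite lerXn2r// nnegrE; lra.
have s2 : sin t ^+ 2 = 1 - cos t ^+ 2 by have := cos2Dsin2 t; lra.
have h1 : 0 <= e * (pi / 2 - t) by rewrite mulr_ge0 ?(ltW e0)//; lra.
have h2 : 0 <= e ^+ 2 * cos t ^+ 2 by rewrite mulr_ge0 ?sqr_ge0.
have h3 := sqr_ge0 (pi / 2 - t).
(* Here [speed2 = e^2 + (1 - e^2) cos^2 t / 2], which is at most [e^2 + (pi/2 - t)^2]. *)
rewrite /speed2 /k /d s2 sqrrD; lra.
Qed.

Lemma half_period0 : half_period 0 = pi :> R.
Proof.
have pi0 := @pi_gt0 R.
rewrite /half_period.
rewrite (@eq_Rintegral _ _ _ mu _ (fun=> 1)) => [|t _]; last first.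
  by rewrite /speed /speed2 mul0r subr0 sqrtr1 invr1.
rewrite Rintegral_cst//= lebesgue_measure_itv/= lte_fin pi0/= oppr0 addr0.
by rewrite mul1r.
Qed.

Lemma half_period_surjective y : pi < y ->
  exists2 k, 0 < k < 1 & half_period k = y.
Proof.
move=> piy; have y0 : 0 < y := lt_trans (@pi_gt0 R) piy.
have [k1 /andP[k10 k11] Bk] := half_period_unbounded y0.
have dT x : x \in `[0, k1] -> is_derive x (1 : R) half_period (half_period' x).
  rewrite in_itv/= => /andP[x0 xk]; apply: is_derive_half_period; lra.
have [|k] := @IVT R half_period 0 k1 y (ltW k10) (within_c_derive dT).
  rewrite half_period0 (min_idPl _) ?(max_idPr _) ?Bk ?andbT ?(ltW piy)//;
    exact: le_trans (ltW piy) Bk.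
rewrite in_itv/= => /andP[k0 kk1] Tk; exists k => //; apply/andP; split.
  rewrite lt_neqAle k0 andbT; apply/eqP => e.
  by move: Tk piy; rewrite -e half_period0 => ->; rewrite ltxx.
exact: le_lt_trans k11.
Qed.

End half_period_derivatives.

(** * The broken energy *)

Section broken_energy.
Context {R : realType}.
Local Notation mu := (@lebesgue_measure R).
Implicit Types (a b x y t k eps : R) (f g u h U F : R -> R).

Lemma half_period_gt0 k : 0 <= k -> k < 1 -> 0 < half_period k :> R.
Proof.
move=> k0 k1; have pi0 := @pi_gt0 R.
rewrite /half_period; apply: (@lt_le_trans _ _ (\int[mu]_(t in `[0, pi]) 1)).
  by rewrite Rintegral_cst//= lebesgue_measure_itv/= lte_fin pi0/= oppr0 addr0 mul1r.
apply: le_Rintegral => //.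
- by apply: seg_integrable_continuous; exact: within_cst.
- by apply: seg_integrable_continuous; exact: within_speedV.
- move=> t _; rewrite -[leLHS]invr1 lef_pV2 ?posrE ?speed_gt0//.
  by rewrite speed_le1.
Qed.

Lemma min_energy_half_energy k eps a b : 0 < k -> k < 1 -> 0 < eps ->
  b - a = eps * half_period k -> min_energy eps a b = half_energy k.
Proof.
move=> k0 k1 eps0 abT.
have T0 := half_period_gt0 (ltW k0) k1.
have ab : a < b by rewrite -subr_gt0 abT mulr_gt0.
have [U [U1 [[Up Ua Ub] [dU dU1 _ _ <-]]]] := profile_exists k0 k1 eps0 abT.
rewrite (critical_min_energy eps0 ab Up Ua Ub dU dU1).
rewrite -(critical_energy eps0 ab Ua Ub dU dU1).
have cU := within_c_derive dU; have cU1 := within_c_derive dU1.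
have HU := critical_H10 Ua Ub dU dU1.
rewrite (energyE _ (ltW ab) HU (is_weak_derivative_C1 dU cU1)).
have i1 : mu.-integrable `[a, b] (EFin \o (fun x => U1 x ^+ 2)).
  by apply: seg_integrable_continuous; exact: within_cX.
have i2 : mu.-integrable `[a, b] (EFin \o (fun x => W (U x))).
  apply: seg_integrable_continuous; rewrite /W.
  apply: within_cM; last exact: within_cst.
  by apply: within_cX; apply: within_cB; [exact: within_cst|exact: within_cX].
have j1 := seg_integrableZ (eps / 2) i1.
have j2 := seg_integrableZ eps^-1 i2.
by rewrite RintegralD// !RintegralZl.
Qed.

(** A nodal solution is given by different formulas on the two sides of a node, so its derivative
    there has to be assembled from matching one-sided slopes. *)
Lemma is_derive_glue f g h c : is_derive (0 : R) (1 : R) f c ->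
  is_derive (0 : R) (1 : R) g c -> h 0 = f 0 -> h 0 = g 0 ->
  (\forall x \near (0 : R), 0 < x -> h x = f x) ->
  (\forall x \near (0 : R), x < 0 -> h x = g x) ->
  is_derive (0 : R) (1 : R) h c.
Proof.
move=> [df fc] [dg gc] hf hg hr hl.
have cf : x^-1 *: ((f \o shift 0) (x *: 1) - f 0) @[x --> (0 : R)^'] --> c.
  by rewrite -fc; exact: df.
have cg : x^-1 *: ((g \o shift 0) (x *: 1) - g 0) @[x --> (0 : R)^'] --> c.
  by rewrite -gc; exact: dg.
suff ch : x^-1 *: ((h \o shift 0) (x *: 1) - h 0) @[x --> (0 : R)^'] --> c.
  by apply: DeriveDef; [apply/cvg_ex; exists c|exact: (cvg_lim _ ch)].
move=> A Ac; have fA := cf A Ac; have gA := cg A Ac.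
rewrite /nbhs /= in fA gA *; near=> x.
have x0 : x != 0 by near: x; exact: nbhs_dnbhs_neq.
have hrx : 0 < x -> h x = f x by near: x; exact: cvg_within hr.
have hlx : x < 0 -> h x = g x by near: x; exact: cvg_within hl.
rewrite /= /GRing.scale /= mulr1 addr0.
have [xn|xp] := ltP x 0.
  rewrite hlx// hg; suff : A (x^-1 *: ((g \o shift 0) (x *: 1) - g 0)).
    by rewrite /= /GRing.scale /= mulr1 addr0.
  by near: x.
rewrite hrx ?lt_neqAle 1?eq_sym ?x0// hf.
suff : A (x^-1 *: ((f \o shift 0) (x *: 1) - f 0)).
  by rewrite /= /GRing.scale /= mulr1 addr0.
by near: x.
Unshelve. all: by end_near. Qed.

(** The chain rule applied twice. The formula for [F] is required only near 0, because the broken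
    energy is known explicitly only while all arcs have length close to [L]. *)
Lemma has_second_derivative_sum n (m m1 : R -> R) (m2 L : R) (d : 'I_n -> R) F :
  (\forall x \near L, is_derive x (1 : R) m (m1 x)) ->
  is_derive L (1 : R) m1 m2 ->
  (\forall t \near (0 : R), F t = \sum_(i < n) m (L + t * d i)) ->
  has_second_derivative F 0 (m2 * \sum_(i < n) d i ^+ 2).
Proof.
move=> dm dm1 FE.
have daff (c t : R) : is_derive t (1 : R) (fun t => L + t * c) c.
  apply: der1_eq (der1D (der1_cst t L) (der1M (is_derive_id t (1 : R)) (der1_cst t c))) _.
  by rewrite add0r mul1r mulr0 addr0.
have nmi i : \forall t \near (0 : R),
    is_derive (L + t * d i) (1 : R) m (m1 (L + t * d i)).
  have := is_derive1_continuous (daff (d i) 0).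
  rewrite /prop_for /continuous_at mul0r addr0 => cd.
  exact: cd _ dm.
have nm := filter_forall _ nmi.
have dsum (h : 'I_n -> R -> R) (h1 : 'I_n -> R) t :
    (forall i, is_derive t (1 : R) (h i) (h1 i)) ->
    is_derive t (1 : R) (fun t => \sum_(i < n) h i t) (\sum_(i < n) h1 i).
  by move=> dh; have := is_derive_sum dh; rewrite fct_sumE.
(* Differentiating [F] at a nearby [t] needs the formula on a neighbourhood of [t], not just at
   [t]. *)
have FE2 := near_join FE.
have dF : \forall t \near (0 : R),
    is_derive t (1 : R) F (\sum_(i < n) m1 (L + t * d i) * d i).
  near=> t.
  have dS : is_derive t (1 : R) (fun t => \sum_(i < n) m (L + t * d i))
      (\sum_(i < n) m1 (L + t * d i) * d i).
    apply: (dsum (fun i t => m (L + t * d i))) => i.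
    have nt : forall i : 'I_n, is_derive (L + t * d i) (1 : R) m (m1 (L + t * d i)).
      by near: t; exact: nm.
    exact: (@der1_comp _ m (fun t => L + t * d i) t _ _ (nt i) (daff (d i) t)).
  apply: near_eq_is_derive dS.
  have : \forall s \near t, F s = \sum_(i < n) m (L + s * d i).
    by near: t; exact: FE2.
  by apply: filterS => s ->.
split; first by apply: filterS dF => t [].
have d1 : is_derive (0 : R) (1 : R) (fun t => \sum_(i < n) m1 (L + t * d i) * d i)
    (m2 * \sum_(i < n) d i ^+ 2).
  rewrite mulr_sumr; apply: (dsum (fun i t => m1 (L + t * d i) * d i)) => i.
  have dm1' : is_derive (L + 0 * d i) (1 : R) m1 m2 by rewrite mul0r addr0.
  have h := @der1_comp _ m1 (fun t => L + t * d i) 0 _ _ dm1' (daff (d i) 0).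
  by apply: der1_eq (der1M h (der1_cst 0 (d i))) _; rewrite mulr0 addr0; ring.
apply: near_eq_is_derive d1; apply: filterS dF => t [_ dFt].
by rewrite derive1E.
Unshelve. all: by end_near. Qed.

Lemma node_gap p (f : 'I_(2 * p) -> R) t i : (1 <= p)%N ->
  next_node (node_variation f t) i - node_variation f t i =
  (2 * p)%:R^-1 + t * (f (ordS i) - f i).
Proof.
move=> hp; have n0 : ((2 * p)%:R : R) != 0 by rewrite pnatr_eq0 muln_eq0/= -lt0n.
rewrite /next_node /node_variation /=.
(* The last arc wraps around: its successor index is 0, and the lift by 1 in [next_node] restores
   the gap. *)
have [e|e] := eqVneq i.+1 (2 * p)%N.
  rewrite e modnn mul0r add0r.
  have iE : (i%:R : R) + 1 = (2 * p)%:R by rewrite natr1 e.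
  have -> : (i%:R : R) = (2 * p)%:R - 1 by rewrite -iE addrK.
  have -> : true%:R = 1 :> R by [].
  by move: (2 * p)%:R n0 => N N0; field.
rewrite modn_small; last by rewrite ltn_neqAle e ltn_ord.
by rewrite -addn1 natrD addr0; move: (2 * p)%:R n0 => N N0; field.
Qed.

(** Just left of 0 the floor is -1 and the function is [- U (x + L)], with slope [- U'(L)] at 0; the
    symmetry [U'(L) = - U'(0)] makes both slopes agree. *)
Lemma is_derive_nodal_solution p up U c (L := (2 * p)%:R^-1 : R) : (1 <= p)%N ->
  (forall x, x \in `[0, L] -> up x = U x) -> U 0 = 0 -> U L = 0 ->
  is_derive (0 : R) (1 : R) U c -> is_derive L (1 : R) U (- c) ->
  is_derive (0 : R) (1 : R) (nodal_solution p up) c.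
Proof.
move=> hp upU U0 UL d0 dL.
have L0 : 0 < L by rewrite invr_gt0 ltr0n muln_gt0.
have nE : (2 * p)%:R = L^-1 :> R by rewrite invrK.
have pos x : 0 <= x -> x < L -> nodal_solution p up x = U x.
  move=> x0 xL; rewrite /nodal_solution.
  have -> : Num.floor (x * (2 * p)%:R) = 0.
    apply: floor_def; rewrite add0r mulr_ge0//= nE.
    by rewrite ltr_pdivrMr// mul1r.
  by rewrite expr0z mul1r mul0r subr0 upU// in_itv/= x0 ltW.
have neg x : - L < x -> x < 0 -> nodal_solution p up x = - U (x + L).
  move=> x0 xL; rewrite /nodal_solution.
  have -> : Num.floor (x * (2 * p)%:R) = -1.
    apply: floor_def; rewrite addNr nE; apply/andP; split.
      by rewrite ler_pdivlMr// mulN1r ltW.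
    by rewrite ltr_pdivrMr// mul0r.
  rewrite -/L; have -> : (-1) ^ (-1) = -1 :> R by rewrite -exprnN expr1 invrN1.
  rewrite mulN1r -/L mulN1r opprK upU// in_itv/=; apply/andP; split; lra.
have dg : is_derive (0 : R) (1 : R) (fun x => - U (x + L)) c.
  have daff : is_derive (0 : R) (1 : R) (fun x => x + L) 1.
    by apply: der1_eq (der1D (is_derive_id 0 (1 : R)) (der1_cst 0 L)) _; rewrite addr0.
  have dL' : is_derive (0 + L) (1 : R) U (- c) by rewrite add0r.
  have h := der1Z (-1) (@der1_comp _ U (fun x => x + L) 0 _ _ dL' daff).
  rewrite (_ : (fun x => _) = fun x => -1 * U (x + L)); last first.
    by apply/funext => x; rewrite mulN1r.
  by apply: der1_eq h _; rewrite mulr1 mulN1r opprK.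
apply: (is_derive_glue d0 dg).
- by rewrite pos.
- by rewrite pos// add0r UL oppr0.
- by near=> x => x0; apply: pos; [exact: ltW|near: x; exact: lt_nbhsl].
- near=> x => x0; apply: neg => //; near: x; apply: lt_nbhsr; lra.
Unshelve. all: by end_near. Qed.

End broken_energy.

Theorem mainTheorem12 (R : realType) (p : nat) (hp : (1 <= p)%N) :
  exists v : R -> R,
  forall eps : R, 0 < eps ->
  forall up : R -> R, positive_minimizer eps 0 ((2 * p)%:R^-1) up ->
  let u := nodal_solution p up in
  let c := derive1 u 0 in
  [/\ v eps < 0,
      derivable u 0 1,
      0 < c &
      forall f : 'I_(2 * p) -> R,
        has_second_derivative (fun t => BE eps (node_variation f t)) 0
          (eps * c ^+ 2 * v eps *
           \sum_(i < 2 * p) (f i - f (ordS i)) ^+ 2)].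
Proof.
have in01 (x : R) : x \in `]0, 1[ -> [/\ 0 < x, -1 < x & x < 1].
  by rewrite in_itv/= => /andP[x0 x1]; split=> //; lra.
have dT (x : R) : x \in `]0, 1[ -> is_derive x (1 : R) half_period (half_period' x).
  by move=> /in01[_ xm x1]; exact: is_derive_half_period.
have Tp (x : R) : x \in `]0, 1[ -> 0 < half_period' x.
  by move=> /in01[x0 _ x1]; apply: half_period'_gt0 => //; exact: ltW.
have [kap kapP] := increasing_inverse dT Tp.
set L : R := (2 * p)%:R^-1.
have L0 : 0 < L by rewrite invr_gt0 ltr0n muln_gt0.
(* [v] is fixed before any minimizer is given, so [m''(L)] and [c^2] are expressed through [kap],
   the inverse of the half period. Where no positive minimizer exists, the value of [v] is not
   constrained. *)
pose m2 eps (k := kap (L / eps)) : R := - (1 - k) / 2 / half_period' k / eps ^+ 2.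
pose c2 eps (k := kap (L / eps)) : R := k * (1 - k / 2) / eps ^+ 2.
exists (fun eps => m2 eps / (eps * c2 eps)) => eps eps0 up upmin u c.
have epsn0 : eps != 0 by rewrite gt_eqF.
have piL : pi < L / eps.
  by rewrite ltr_pdivlMr//; have := positive_minimizer_length eps0 L0 upmin; rewrite subr0.
have [k /andP[k0 k1] Tk] := half_period_surjective piL.
have kI : k \in `]0, 1[ by rewrite in_itv/= k0.
have [kapk [dkap nkap]] := kapP k kI.
rewrite Tk in kapk dkap nkap.
have LT : L - 0 = eps * half_period k by rewrite Tk subr0 mulrC divfK.
have [U [U1 [[Up U0 UL] [dU dU1 U10 U1L _]]]] := profile_exists k0 k1 eps0 LT.
have upU := positive_minimizer_unique eps0 L0 Up U0 UL dU dU1 upmin.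
have I0 : (0 : R) \in `[0, L] by rewrite in_itv/= lexx ltW.
have IL : L \in `[0, L] by rewrite in_itv/= lexx ltW.
have dL := dU L IL; rewrite U1L in dL.
have du := is_derive_nodal_solution hp upU U0 UL (dU 0 I0) dL.
have kk : 0 < k * (1 - k / 2) by apply: mulr_gt0 => //; lra.
have cE : c = Num.sqrt (k * (1 - k / 2)) / eps.
  by rewrite /c derive1E -U10; have [_ ->] := du.
have c0 : 0 < c by rewrite cE divr_gt0// sqrtr_gt0.
have c2E : c2 eps = c ^+ 2.
  by rewrite /c2 kapk cE exprMn exprVn sqr_sqrtr// ltW.
have m2lt0 : m2 eps < 0.
  rewrite /m2 kapk; have := Tp k kI => T'0.
  rewrite !mulNr oppr_lt0 !divr_gt0// ?exprn_gt0//; lra.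
split=> //.
- by rewrite pmulr_llt0// invr_gt0 mulr_gt0// c2E exprn_gt0.
move=> f.
(* The definition of [v] cancels [eps * c ^+ 2] and leaves [m''(L)]. *)
have -> : eps * c ^+ 2 * (m2 eps / (eps * c2 eps)) *
    \sum_(i < 2 * p) (f i - f (ordS i)) ^+ 2 =
    m2 eps * \sum_(i < 2 * p) (f (ordS i) - f i) ^+ 2.
  congr (_ * _); first by rewrite c2E; field; rewrite epsn0 gt_eqF.
  by apply: eq_bigr => i _; rewrite -sqrrN opprB.
pose kL x := kap (x / eps).
have ceps : (fun x : R => x / eps) x @[x --> L] --> L / eps.
  by apply: cvgM; [exact: cvg_id|exact: cvg_cst].
have nkL : \forall x \near L, half_period (kL x) = x / eps /\ (kL x \in `]0, 1[).
  exact: ceps _ nkap.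
have daff (x : R) : is_derive x (1 : R) (fun x => x / eps) eps^-1.
  apply: der1_eq (der1M (is_derive_id x (1 : R)) (der1_cst x eps^-1)) _.
  by rewrite mul1r mulr0 addr0.
have dkL x : half_period (kL x) = x / eps -> kL x \in `]0, 1[ ->
    is_derive x (1 : R) kL ((half_period' (kL x))^-1 / eps).
  move=> Tx kx; have [_ [dk _]] := kapP _ kx.
  rewrite Tx in dk.
  exact: (@der1_comp _ kap (fun x => x / eps) x _ _ dk (daff x)).
apply: (@has_second_derivative_sum _ _ (fun x => half_energy (kL x))
  (fun x => level (kL x) / eps) (m2 eps) L (fun i => f (ordS i) - f i)).
- near=> x.
  have [Tx kx] : half_period (kL x) = x / eps /\ (kL x \in `]0, 1[) by near: x.
  have [_ xm x1] := in01 _ kx.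
  have h := @der1_comp _ half_energy kL x _ _ (is_derive_half_energy xm x1) (dkL x Tx kx).
  apply: der1_eq h _.
  by field; rewrite epsn0 gt_eqF// Tp.
- have [TL kLI] := nbhs_singleton nkL.
  have kLE : kL L = k by rewrite /kL kapk.
  have dl : is_derive (kL L) (1 : R) (@level R) (- (1 - kL L) / 2).
    have d1 := der1B (der1_cst (kL L) 1) (is_derive_id (kL L) (1 : R)).
    by apply: der1_eq (der1M (der1M d1 d1) (der1_cst (kL L) 4^-1)) _; field.
  have h := der1M (@der1_comp _ (@level R) kL L _ _ dl (dkL L TL kLI)) (der1_cst L eps^-1).
  apply: der1_eq h _; rewrite mulr0 addr0 /m2 kapk kLE.
  by field; rewrite epsn0 gt_eqF// Tp.
(* For small [t] each perturbed arc still has a profile of its own; as there are finitely many arcs,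
   one neighbourhood of 0 serves them all. *)
have gapi (i : 'I_(2 * p)) : \forall t \near (0 : R),
    half_period (kL (L + t * (f (ordS i) - f i))) =
      (L + t * (f (ordS i) - f i)) / eps /\
    (kL (L + t * (f (ordS i) - f i)) \in `]0, 1[).
  have ct : L + t * (f (ordS i) - f i) @[t --> (0 : R)] -->
      L + 0 * (f (ordS i) - f i).
    by apply: cvgD; [exact: cvg_cst|apply: cvgM; [exact: cvg_id|exact: cvg_cst]].
  rewrite mul0r addr0 in ct.
  exact: ct _ nkL.
have gap := filter_forall _ gapi.
near=> t; rewrite /BE; apply: eq_bigr => i _.
have [Ti /in01[ki0 _ ki1]] : half_period (kL (L + t * (f (ordS i) - f i))) =
      (L + t * (f (ordS i) - f i)) / eps /\
    (kL (L + t * (f (ordS i) - f i)) \in `]0, 1[) by move: i; near: t; exact: gap.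
apply: min_energy_half_energy => //.
by rewrite Ti node_gap// [RHS]mulrC divfK.
Unshelve. all: by end_near. Qed.
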